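(* Under the Setup and the Conditional asymptotic regime described in the context, for $i,j\in\{0,1\}$, $$\lim_{p\to\infty}E_{S_n}[\hat\varepsilon_i^B\varepsilon_j\mid\boldsymbol\mu]=\Phi\!\left((-1)^i\frac{-G_i^B+c}{\sqrt D}\right)\Phi\!\left((-1)^j\frac{-G_j+c}{\sqrt D}\right),$$ and consequently $$\lim_{p\to\infty}E_{S_n}[\hat\varepsilon^B\varepsilon\mid\boldsymbol\mu]=\sum_{i=0}^1\sum_{j=0}^1\alpha_i\alpha_j\,\Phi\!\left((-1)^i\frac{-G_i^B+c}{\sqrt D}\right)\Phi\!\left((-1)^j\frac{-G_j+c}{\sqrt D}\right),$$ where $G_0^B=\frac{1}{2(1+\gamma_0)}\big(\gamma_0(\bar\eta_{\mathbf m_0,\boldsymbol\mu_1}-\bar\eta_{\mathbf m_0,\boldsymbol\mu_0})+\bar\delta^2_{\boldsymbol\mu}+(1-\gamma_0)J_0+(1+\gamma_0)J_1\big)$, $G_1^B=\frac{-1}{2(1+\gamma_1)}\big(\gamma_1(\bar\eta_{\mathbf m_1,\boldsymbol\mu_0}-\bar\eta_{\mathbf m_1,\boldsymbol\mu_1})+\bar\delta^2_{\boldsymbol\mu}+(1-\gamma_1)J_1+(1+\gamma_1)J_0\big)$, $G_0=\frac12(\bar\delta^2_{\boldsymbol\mu}+J_1-J_0)$, $G_1=-\frac12(\bar\delta^2_{\boldsymbol\mu}+J_0-J_1)$, and $D=\bar\delta^2_{\boldsymbol\mu}+J_0+J_1$.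
   Context: Setup. Fix $\alpha_0\in(0,1)$, $\alpha_1=1-\alpha_0$, and $c=\log\frac{1-\alpha_0}{\alpha_0}$. $\Phi$ is the standard normal CDF. For each dimension $p$ there is a known symmetric positive definite $p\times p$ matrix $\Sigma$, class means $\boldsymbol\mu_0,\boldsymbol\mu_1\in\mathbb R^p$, sample sizes $n_0,n_1$, prior means $\mathbf m_0,\mathbf m_1\in\mathbb R^p$ and prior certainty parameters $\nu_0,\nu_1>0$ (all depending on $p$; the index $p$ is suppressed). Class $i$ has distribution $\Pi_i=N(\boldsymbol\mu_i,\Sigma)$. The sample $S_n$ consists of $n_0$ i.i.d. points from $\Pi_0$ and, independently, $n_1$ i.i.d. points from $\Pi_1$; $\bar{\mathbf x}_0,\bar{\mathbf x}_1$ are the class sample means. The LDA classifier assigns $\mathbf x$ to class 1 if $W(\mathbf x)\le c$ and to class 0 otherwise, where $W(\mathbf x)=(\mathbf x-\frac{\bar{\mathbf x}_0+\bar{\mathbf x}_1}{2})^T\Sigma^{-1}(\bar{\mathbf x}_0-\bar{\mathbf x}_1)$. Let $\hat\delta^2=(\bar{\mathbf x}_0-\bar{\mathbf x}_1)^T\Sigma^{-1}(\bar{\mathbf x}_0-\bar{\mathbf x}_1)$. The true error is $\varepsilon=\alpha_0\varepsilon_0+\alpha_1\varepsilon_1$ with $\varepsilon_i=\Phi\Big(\frac{(-1)^{i+1}(\boldsymbol\mu_i-\frac{\bar{\mathbf x}_0+\bar{\mathbf x}_1}{2})^T\Sigma^{-1}(\bar{\mathbf x}_0-\bar{\mathbf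 x}_1)+(-1)^i c}{\hat\delta}\Big)$. The Bayesian MMSE error estimator (for the prior $\boldsymbol\mu_i\sim N(\mathbf m_i,\Sigma/\nu_i)$, $i=0,1$, independent) is $\hat\varepsilon^B=\alpha_0\hat\varepsilon^B_0+\alpha_1\hat\varepsilon^B_1$ with $\hat\varepsilon_i^B=\Phi\Big((-1)^i\frac{-(\mathbf m_i^*-\frac{\bar{\mathbf x}_0+\bar{\mathbf x}_1}{2})^T\Sigma^{-1}(\bar{\mathbf x}_0-\bar{\mathbf x}_1)+c}{\hat\delta}\sqrt{\frac{\nu_i^*}{\nu_i^*+1}}\Big)$, where $\mathbf m_i^*=\frac{n_i\bar{\mathbf x}_i+\nu_i\mathbf m_i}{n_i+\nu_i}$ and $\nu_i^*=n_i+\nu_i$. Notation: $\eta_{\mathbf a,\mathbf b}=(\mathbf a-\mathbf b)^T\Sigma^{-1}(\mathbf a-\mathbf b)$, $\delta^2_{\boldsymbol\mu}=\eta_{\boldsymbol\mu_0,\boldsymbol\mu_1}$; a bar denotes the limit as $p\to\infty$ of the corresponding quantity. Conditional asymptotic regime. $\boldsymbol\mu_0,\boldsymbol\mu_1$ are deterministic for each $p$, and expectations $E_{S_n}[\cdot\mid\boldsymbol\mu]$ are over the sample only. As $p\to\infty$: $n_0,n_1,\nu_0,\nu_1\to\infty$, $p/n_i\to J_i\in[0,\infty)$, $\nu_i/n_i\to\gamma_i\in[0,\infty)$, and for all $i,j\in\{0,1\}$ the quantities $\mathbf m_i^T\Sigma^{-1}\boldsymbol\mu_j$, $\mathbf m_i^T\Sigma^{-1}\mathbf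 m_j$, $\boldsymbol\mu_i^T\Sigma^{-1}\boldsymbol\mu_j$ converge to finite limits (so all the $\eta$'s above converge). It is assumed that $D=\bar\delta^2_{\boldsymbol\mu}+J_0+J_1>0$. $\lim_{p\to\infty}$ denotes the limit along this regime. *)

(* Defs.v *)
From HB Require Import structures.
From mathcomp Require Import all_boot all_order all_algebra.
From mathcomp Require Import all_classical all_reals all_analysis.
Set Implicit Arguments. Unset Strict Implicit. Unset Printing Implicit Defensive.
Import Order.TTheory GRing.Theory Num.Theory.
Import numFieldNormedType.Exports.
Local Open Scope classical_set_scope.
Local Open Scope ring_scope.

Section Defs.
Context {R : realType}.

Definition Phi (x : R) : R := fine (normal_prob 0 1 `]-oo, x]).

Definition cthr (alpha0 : R) : R := ln ((1 - alpha0) / alpha0).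

Definition qf (p : nat) (S : 'M[R]_p) (u v : 'cV[R]_p) : R :=
  (u^T *m invmx S *m v) 0 0.

Definition etaq (p : nat) (S : 'M[R]_p) (a b : 'cV[R]_p) : R := qf S (a - b) (a - b).

Definition spd (p : nat) (S : 'M[R]_p) : Prop :=
  S^T = S /\ forall v : 'cV[R]_p, v != 0 -> 0 < (v^T *m S *m v) 0 0.

Definition smean (p n : nat) (x : 'I_n -> 'cV[R]_p) : 'cV[R]_p :=
  (n%:R)^-1 *: \sum_(k < n) x k.

Definition lda_err (p : nat) (S : 'M[R]_p) (c : R) (mui xb0 xb1 : 'cV[R]_p)
  (i : nat) : R :=
  let dhat := Num.sqrt (qf S (xb0 - xb1) (xb0 - xb1)) in
  Phi (((-1) ^+ i.+1 * qf S (mui - (2%:R)^-1 *: (xb0 + xb1)) (xb0 - xb1)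
        + (-1) ^+ i * c) / dhat).

Definition bayes_err (p : nat) (S : 'M[R]_p) (c : R) (ni : nat) (nui : R)
  (mi xbi xb0 xb1 : 'cV[R]_p) (i : nat) : R :=
  let dhat := Num.sqrt (qf S (xb0 - xb1) (xb0 - xb1)) in
  let mstar := (ni%:R + nui)^-1 *: (ni%:R *: xbi + nui *: mi) in
  let nustar := ni%:R + nui in
  Phi ((-1) ^+ i * ((- qf S (mstar - (2%:R)^-1 *: (xb0 + xb1)) (xb0 - xb1) + c)
                     / dhat) * Num.sqrt (nustar / (nustar + 1))).

End Defs.

Section Prob.
Context {d : measure_display} {T : measurableType d} {R : realType}.

Definition rvec (p : nat) (X : T -> 'cV[R]_p) : Prop :=
  forall l : 'I_p, measurable_fun setT (fun t => X t l ord0).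

(* X ~ N(mu, S) (Cramer-Wold definition): every nonzero linear form a^T X
   is a real normal r.v. with mean a^T mu and variance a^T S a *)
Definition gaussian_vec (P : probability T R) (p : nat) (X : T -> 'cV[R]_p)
  (mu : 'cV[R]_p) (S : 'M[R]_p) : Prop :=
  rvec X /\
  forall a : 'cV[R]_p, a != 0 -> forall B : set R, measurable B ->
    P [set t | B ((a^T *m X t) 0 0)] =
    normal_prob ((a^T *m mu) 0 0) (Num.sqrt ((a^T *m S *m a) 0 0)) B.

(* mutual independence of a finite family of random vectors
   (product rule on measurable rectangles, which generate the product
   sigma-algebras and form a pi-system) *)
Definition indep_vecs (P : probability T R) (I : finType) (p : nat)
  (X : I -> T -> 'cV[R]_p) : Prop :=
  forall B : I -> 'I_p -> set R, (forall i l, measurable (B i l)) ->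
    P (\bigcap_(i in [set: I]) [set t | forall l, B i l (X i t l ord0)]) =
    (\prod_(i : I) P [set t | forall l, B i l (X i t l ord0)])%E.

End Prob.

(* Main.v *)
(** Write each class mean as [mu_i] plus a noise vector, the average of the
    centered sample.  Both error probabilities are continuous functions of
    finitely many bilinear forms in [invmx Sigma], evaluated at the two sample
    means and at [mu_0, mu_1, m_0, m_1].  Each of these forms converges in
    probability to a constant: after whitening, the terms [<y_k, y_l> - p [k = l]]
    are centered and pairwise uncorrelated up to swapping [k] and [l], with
    second moment [p] off the diagonal and [O(p^2)] on it, so that
    [<zbar_i, zbar_i> - p / n_i] has second moment
    [O(p / n_i^2 + p^2 / n_i^3)], which tends to 0; the cross term and the linear
    terms are handled alike.  The errors therefore converge in probability to
    constants and, being bounded, so do the expectations of their products. *)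

Require Import Defs.
From HB Require Import structures.
From mathcomp Require Import all_boot all_order all_algebra.
From mathcomp Require Import all_classical all_reals all_analysis.
From mathcomp Require Import measurable_realfun ring lra.
Import Order.TTheory GRing.Theory Num.Theory.
Import numFieldNormedType.Exports.
Local Open Scope classical_set_scope.
Local Open Scope ring_scope.
Set Implicit Arguments.
Unset Strict Implicit.
Unset Printing Implicit Defensive.

(** * Moments of the normal distribution *)

Section NormalMoments.
Context {R : realType}.
Notation lambda := (@lebesgue_measure R).

Lemma ae_eq_normal_pdf (m s : R) :
  ae_eq lambda setT (Radon_Nikodym_SigmaFinite.f (normal_prob m s) lambda)
    (EFin \o normal_pdf m s).
Proof.
have dom := normal_prob_dominates m s.
apply: integral_ae_eq => //.
- exact: Radon_Nikodym_SigmaFinite.f_integrable.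
- by apply/measurable_EFinP; exact: measurable_normal_pdf.
- by move=> E _ mE; rewrite -Radon_Nikodym_SigmaFinite.f_integral.
Qed.

Lemma ge0_integral_normal_prob (m s : R) (f : R -> \bar R) :
    (forall x, (0 <= f x)%E) -> measurable_fun setT f ->
  (\int[normal_prob m s]_x f x =
   \int[lambda]_x (f x * (normal_pdf m s x)%:E))%E.
Proof.
move=> f0 mf; have dom := normal_prob_dominates m s.
rewrite -(Radon_Nikodym_SigmaFinite.change_of_variables dom)//.
apply: ae_eq_integral => //.
- apply: emeasurable_funM => //; apply: measurable_int.
  exact: Radon_Nikodym_SigmaFinite.f_integrable.
- apply: emeasurable_funM => //.
  by apply/measurable_EFinP; exact: measurable_normal_pdf.
- exact/ae_eqe_mul2l/ae_eq_normal_pdf.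
Qed.

Lemma integral_normal_prob (m s : R) (f : R -> R) :
    (normal_prob m s).-integrable setT (EFin \o f) ->
  (\int[normal_prob m s]_x (f x)%:E =
   \int[lambda]_x (f x * normal_pdf m s x)%:E)%E.
Proof.
move=> intf; have dom := normal_prob_dominates m s.
have mf : measurable_fun setT f .
  by apply/measurable_EFinP; exact: measurable_int intf.
rewrite -(Radon_Nikodym_change_of_variables dom)//.
apply: ae_eq_integral => //.
- apply: emeasurable_funM; first exact/measurable_EFinP.
  by apply: measurable_int; exact: Radon_Nikodym_integrable.
- apply/measurable_EFinP/measurable_funM => //; exact: measurable_normal_pdf.
- under [X in ae_eq _ _ _ X]eq_fun do rewrite EFinM.
  apply: ae_eqe_mul2l.
  apply: ae_eq_trans (ae_eq_normal_pdf m s).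
  exact/ae_eq_sym/ae_eq_Radon_Nikodym_SigmaFinite.
Qed.

Lemma exprn_le_expR (n : nat) (u : R) : 0 <= u -> u ^+ n <= n%:R ^+ n * expR u.
Proof.
move=> u0; case: n => [|n]; first by rewrite !expr0 mul1r -expR0 ler_expR.
have n0 : 0 < n.+1%:R :> R by [].
have -> : u = n.+1%:R * (u / n.+1%:R) by rewrite mulrC divfK ?gt_eqF.
rewrite expRM_natl exprMn ler_pM2l ?exprn_gt0// lerXn2r ?nnegrE ?expR_ge0//.
  by rewrite divr_ge0.
by apply: le_trans (expR_ge1Dx _); rewrite lerDr.
Qed.

Lemma normal_pdf1E (m x : R) :
  normal_pdf m 1 x = normal_peak 1 * expR (- (x - m) ^+ 2 / 2).
Proof. by rewrite normal_pdfE ?oner_neq0// /normal_fun expr1n. Qed.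

(* Doubling the variance absorbs any power: u^n exp(-2u) <= n^n exp(-u) with
   u = (x - m)^2 / 4. *)
Lemma normal_moment_le (n : nat) : exists C : R, forall m x : R,
  (x - m) ^+ n.*2 * normal_pdf m 1 x <= C * normal_pdf m (Num.sqrt 2) x.
Proof.
have s2 : Num.sqrt 2 != 0 :> R by rewrite sqrtr_eq0 -ltNge.
pose k1 : R := normal_peak 1; pose k2 : R := normal_peak (Num.sqrt 2).
have k10 : 0 < k1 by rewrite normal_peak_gt0 ?oner_neq0.
have k20 : 0 < k2 by rewrite normal_peak_gt0.
exists (4 ^+ n * n%:R ^+ n * k1 / k2) => m x.
rewrite normal_pdf1E (normal_pdfE _ s2) /normal_fun sqr_sqrtr//.
set u := (x - m) ^+ 2 / 4.
have u0 : 0 <= u by rewrite divr_ge0 ?sqr_ge0.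
have -> : (x - m) ^+ n.*2 = 4 ^+ n * u ^+ n.
  by rewrite -mul2n exprM -exprMn; congr (_ ^+ n); rewrite /u; field.
have -> : - (x - m) ^+ 2 / 2 = - u - u by rewrite /u; field.
have -> : - (x - m) ^+ 2 / (2 *+ 2) = - u by rewrite /u; field.
rewrite expRD -/k1 -/k2.
rewrite [leRHS](_ : _ = 4 ^+ n * (n%:R ^+ n * (k1 * expR (- u)))); last first.
  by field; rewrite gt_eqF.
rewrite -mulrA ler_pM2l ?exprn_gt0//.
rewrite [leLHS](_ : _ = (u ^+ n * expR (- u)) * (k1 * expR (- u))); last by ring.
rewrite ler_wpM2r ?mulr_ge0 ?expR_ge0 ?(ltW k10)//.
by rewrite expRN ler_pdivrMr ?expR_gt0// exprn_le_expR.
Qed.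

Lemma normal_even_moment_bound (n : nat) : exists C : R, forall m,
  (\int[normal_prob m 1]_x ((x - m) ^+ n.*2)%:E <= C%:E)%E.
Proof.
have [C hC] := normal_moment_le n; exists C => m.
have mX : measurable_fun setT (fun x : R => (x - m) ^+ n.*2 : R).
  by apply: measurable_funX; exact: measurable_funB.
have p0 x : 0 <= (x - m) ^+ n.*2 :> R by rewrite -mul2n exprM exprn_ge0 ?sqr_ge0.
rewrite ge0_integral_normal_prob//; last exact/measurable_EFinP.
apply: (@le_trans _ _
    (\int[lambda]_x (C * normal_pdf m (Num.sqrt 2) x)%:E)%E).
  apply: ge0_le_integral => //.
  - by move=> x _; rewrite -EFinM lee_fin mulr_ge0 ?normal_pdf_ge0.
  - apply/measurable_EFinP/measurable_funM => //; exact: measurable_normal_pdf.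
  - apply/measurable_EFinP/measurable_funM => //; exact: measurable_normal_pdf.
  - by move=> x _; rewrite -EFinM lee_fin.
under eq_integral do rewrite EFinM.
rewrite integralZl//=; last exact: integrable_normal_pdf.
by rewrite integral_normal_pdf mule1.
Qed.

Lemma integrable_normal_even_moment (m : R) (n : nat) :
  (normal_prob m 1).-integrable setT (fun x => ((x - m) ^+ n.*2)%:E).
Proof.
have [C /(_ m) hC] := normal_even_moment_bound n.
apply/integrableP; split.
  by apply/measurable_EFinP/measurable_funX; exact: measurable_funB.
apply: le_lt_trans (ltry C); apply: le_trans hC.
have p0 x : 0 <= (x - m) ^+ n.*2 :> R by rewrite -mul2n exprM exprn_ge0 ?sqr_ge0.
by under eq_integral do rewrite gee0_abs ?lee_fin ?p0//.
Qed.

Lemma ler_normX_even (n : nat) (x : R) : `|x| ^+ n <= 1 + x ^+ n.*2.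
Proof.
have -> : x ^+ n.*2 = (`|x| ^+ n) ^+ 2.
  by rewrite -exprM muln2 -mul2n !exprM real_normK ?num_real.
set y := _ ^+ n; nra.
Qed.

Lemma integrable_normal_moment (m : R) (n : nat) :
  (normal_prob m 1).-integrable setT (fun x => (`|x - m| ^+ n)%:E).
Proof.
have h : (normal_prob m 1).-integrable setT
    (fun x => (cst 1 x)%:E + ((x - m) ^+ n.*2)%:E)%E.
  apply: integrableD => //; last exact: integrable_normal_even_moment.
  exact: finite_measure_integrable_cst.
apply: le_integrable h => //.
  apply/measurable_EFinP/measurable_funX/measurableT_comp => //.
  exact: measurable_funB.
move=> x _; rewrite -EFinD !abse_EFin lee_fin.
apply: le_trans (ler_norm _); rewrite ger0_norm ?exprn_ge0//.
exact: ler_normX_even.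
Qed.

Lemma integral_deriv_eq0 (f F : R -> R) :
    continuous f -> (forall x : R, is_derive x (1 : R) F (f x)) ->
    lambda.-integrable setT (EFin \o f) ->
    (exists K m, forall x, `|F x| * `|x - m| <= K) ->
  (\int[lambda]_x (f x)%:E = 0)%E.
Proof.
move=> cf dF intf [K [m FK]].
have mf : measurable_fun setT f by exact: continuous_measurable_fun.
have cF : continuous F.
  move=> x; apply: differentiable_continuous; apply/derivable1_diffP.
  by apply: ex_derive; exact: dF.
pose I n : set R := `[- n.+1%:R, n.+1%:R]%classic.
pose g n x := (f x * \1_(I n) x)%:E.
have FTC n : (\int[lambda]_x g n x = (F n.+1%:R - F (- n.+1%:R))%:E)%E.
  rewrite EFinB -(@continuous_FTC2 _ f F).
  - rewrite [RHS]integral_mkcond; apply: eq_integral => x _.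
    rewrite /g patchE indicE.
    by case: ifP => _; rewrite ?mulr1 ?mulr0.
  - by rewrite gtrN.
  - exact: continuous_subspaceT.
  - split.
    + by move=> x _; apply: ex_derive; exact: dF.
    + by apply: cvg_at_right_filter; exact: cF.
    + by apply: cvg_at_left_filter; exact: cF.
  - by move=> x _; rewrite derive1E; exact: derive_val.
have [|||||_ _] := @dominated_convergence _ _ _ lambda setT measurableT g
    (EFin \o f) (fun x => `|(f x)%:E|%E).
- move=> n; apply/measurable_EFinP/measurable_funM => //.
  by apply: measurable_indic; exact: measurable_itv.
- exact/measurable_EFinP.
- apply: aeW => x _; apply: cvg_near_cst.
  exists (Num.truncn `|x|) => //= n xn.
  rewrite /g indicE mem_set ?mulr1//=; rewrite /I/= in_itv/= -ler_norml.
  apply: ltW; apply: lt_le_trans (truncnS_gt _) _.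
  by rewrite ler_nat ltnS.
- exact: integrable_abse.
- apply: aeW => x n _; rewrite /g/= lee_fin normrM ler_piMr// indicE.
  by case: (_ \in _); rewrite ?normr1 ?normr0.
under eq_fun do rewrite FTC.
move=> h1; apply: cvg_unique h1 _ => //=.
apply: cvg_EFin; first exact: nearW.
apply/cvgr0Pnorm_le => e e0; near=> n.
have nK : `|m| + ((`|K| + 1) / (e / 2)) <= n%:R.
  by near: n; exact: nbhs_infty_ger.
have e20 : 0 < e / 2 by rewrite divr_gt0.
have FKe x : (`|K| + 1) / (e / 2) <= `|x - m| -> `|F x| <= e / 2.
  rewrite ler_pdivrMr// => xm; rewrite leNgt; apply/negP => eF.
  have : `|F x| * `|x - m| <= `|K| by apply: le_trans (FK x) (ler_norm K).
  apply/negP; rewrite -ltNge; apply: (@lt_le_trans _ _ (`|K| + 1)).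
    by rewrite ltrDl.
  by apply: le_trans xm _; rewrite mulrC ler_wpM2r// ltW.
have n1 : n%:R <= n.+1%:R :> R by rewrite ler_nat.
have mle := ler_norm m; have mge := ler_norm (- m); rewrite normrN in mge.
rewrite /comp/= (splitr e); apply: le_trans (ler_normB _ _) (lerD _ _); apply: FKe.
  by apply: le_trans (ler_norm _); lra.
by rewrite -[leRHS]normrN; apply: le_trans (ler_norm _); lra.
Unshelve. all: by end_near.
Qed.

Lemma normal_tail (m : R) : exists K,
  forall x, normal_pdf m 1 x * `|x - m| <= K /\ normal_pdf m 1 x * (x - m) ^+ 2 <= K.
Proof.
have [C /(_ m) hC] := normal_moment_le 1.
have s2 : Num.sqrt 2 != 0 :> R by rewrite sqrtr_eq0 -ltNge.
pose k1 : R := normal_peak 1; pose k2 : R := normal_peak (Num.sqrt 2).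
exists (k1 + `|C| * k2) => x.
have p0 := normal_pdf_ge0 m 1 x; have p1 := normal_pdf_ub m x (@oner_neq0 R).
have q0 := normal_pdf_ge0 m (Num.sqrt 2) x; have q1 := normal_pdf_ub m x s2.
have h2 : normal_pdf m 1 x * (x - m) ^+ 2 <= `|C| * k2.
  rewrite mulrC; apply: le_trans (hC x) _.
  apply: le_trans (ler_wpM2r q0 (ler_norm C)) _.
  by rewrite ler_wpM2l.
split; last by apply: le_trans h2 _; rewrite lerDr normal_peak_ge0.
apply: le_trans (_ : normal_pdf m 1 x * (1 + (x - m) ^+ 2) <= _).
  rewrite ler_wpM2l//; have := ler_normX_even 1 (x - m).
  by rewrite expr1.
by rewrite mulrDr mulr1 lerD.
Qed.

Let dnormal (m : R) (x : R) :
  is_derive x (1 : R) (normal_pdf m 1) (- (x - m) * normal_pdf m 1 x).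
Proof.
have -> : normal_pdf m 1 = (fun y => normal_peak 1 * expR (- (y - m) ^+ 2 / 2)).
  by apply/funext => y; rewrite normal_pdf1E.
have h1 : is_derive x (1 : R) (fun y : R => - (y - m) ^+ 2 / 2) (- (x - m)).
  by apply: is_derive_eq; rewrite /GRing.scale/=; field.
have h2 : is_derive x (1 : R) (expR \o (fun y : R => - (y - m) ^+ 2 / 2))
    (expR (- (x - m) ^+ 2 / 2) * - (x - m)).
  exact: (@is_derive1_comp _ expR _ x _ _ (is_derive_expR _) h1).
apply: is_derive_eq.
rewrite /GRing.scale/=; ring.
Qed.

Let continuous_pdf (m : R) : continuous (normal_pdf m 1).
Proof. by apply: continuous_normal_pdf; exact: oner_neq0. Qed.

Let continuous_centered (m : R) : continuous (fun x : R => x - m).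
Proof. by move=> x; apply: cvgB; [exact: cvg_id|exact: cvg_cst]. Qed.

Lemma integrable_mul_normal_pdf (m s : R) (f : R -> R) :
    measurable_fun setT f ->
    (normal_prob m s).-integrable setT (fun x => (`|f x|)%:E) ->
  lambda.-integrable setT (fun x => (f x * normal_pdf m s x)%:E).
Proof.
move=> mf /integrableP[_ intf]; apply/integrableP; split.
  by apply/measurable_EFinP/measurable_funM => //; exact: measurable_normal_pdf.
move: intf; rewrite ge0_integral_normal_prob//; last first.
  by apply: measurableT_comp => //; apply/measurable_EFinP/measurableT_comp.
congr (_ < _)%E; apply: eq_integral => x _.
by rewrite -EFinM/= normr_id normrM (ger0_norm (normal_pdf_ge0 _ _ _)).
Qed.

Lemma integral_normal_centered (m : R) :
  (\int[normal_prob m 1]_x (x - m)%:E = 0)%E.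
Proof.
have mc : measurable_fun setT (fun x : R => x - m) by exact: measurable_funB.
have i1 : (normal_prob m 1).-integrable setT (fun x => (`|x - m|)%:E).
  exact: (integrable_normal_moment m 1).
rewrite integral_normal_prob; last first.
  by apply: le_integrable i1 => //=; [exact/measurable_EFinP|
    move=> x _; rewrite lee_fin normr_id].
apply: (@integral_deriv_eq0 _ (fun x => - normal_pdf m 1 x)).
- move=> x; apply: cvgM; [exact: continuous_centered|exact: continuous_pdf].
- move=> x; have := dnormal m x => h.
  by apply: is_derive_eq; rewrite mulNr opprK.
- exact: integrable_mul_normal_pdf.
- have [K hK] := normal_tail m; exists K, m => x.
  by rewrite normrN ger0_norm ?normal_pdf_ge0//; have [] := hK x.
Qed.

Lemma integral_normal_variance (m : R) :
  (\int[normal_prob m 1]_x ((x - m) ^+ 2)%:E = 1)%E.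
Proof.
have mc : measurable_fun setT (fun x : R => (x - m) ^+ 2).
  by apply: measurable_funX; exact: measurable_funB.
have i1 : (normal_prob m 1).-integrable setT (fun x => (`|(x - m) ^+ 2|)%:E).
  have := integrable_normal_moment m 2.
  by under eq_fun do rewrite -normrX.
have il := integrable_mul_normal_pdf mc i1.
rewrite integral_normal_prob; last first.
  by apply: le_integrable i1 => //=; [exact/measurable_EFinP|
    move=> x _; rewrite lee_fin normr_id].
have : (\int[lambda]_x ((x - m) ^+ 2 * normal_pdf m 1 x - normal_pdf m 1 x)%:E = 0)%E.
  apply: (@integral_deriv_eq0 _ (fun x => - ((x - m) * normal_pdf m 1 x))).
  - move=> x; apply: cvgB; last exact: continuous_pdf.
    apply: cvgM; last exact: continuous_pdf.
    by rewrite expr2; apply: cvgM; exact: continuous_centered.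
  - move=> x; have := dnormal m x => h.
    by apply: is_derive_eq; rewrite /GRing.scale/=; ring.
  - exact: (integrableB measurableT il (integrable_normal_pdf m 1)).
  - have [K hK] := normal_tail m; exists K, m => x.
    rewrite normrN normrM (ger0_norm (normal_pdf_ge0 _ _ _)) mulrAC -normrM -expr2.
    by rewrite ger0_norm ?sqr_ge0// mulrC; have [] := hK x.
under eq_integral do rewrite EFinB.
rewrite integralB//; last exact: integrable_normal_pdf.
have fn := integrable_fin_num measurableT il.
rewrite integral_normal_pdf => /eqP.
by rewrite sube_eq ?add0e ?fin_num_adde_defl// => /eqP.
Qed.

End NormalMoments.

(** * Whitening *)

Section LinearAlgebra.
Context {R : realType}.

Lemma spd_whitening (p : nat) (S : 'M[R]_p) :
  spd S -> exists A : 'M[R]_p, A *m S *m A^T = 1%:M.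
Proof.
elim: p S => [|p IH] S [symS posS].
  by exists 1%:M; apply/matrixP => -[].
pose s := S 0 0.
have s_gt0 : 0 < s.
  have := posS (delta_mx 0 0); rewrite trmx_delta -rowE -colE !mxE; apply.
  by apply/eqP => /matrixP/(_ 0 0)/eqP; rewrite !mxE !eqxx oner_eq0.
pose S1 : 'M[R]_(1 + p) := S.
pose v := dlsubmx S1; pose S' := drsubmx S1.
have symS1 : S1^T = S1 by [].
have symS' : S'^T = S' by rewrite /S' trmx_drsub symS1.
have urS : ursubmx S1 = v^T by rewrite /v trmx_dlsub symS1.
have S1E : S1 = block_mx s%:M v^T v S'.
  rewrite -[LHS]submxK urS; congr block_mx.
  by rewrite [LHS]mx11_scalar !mxE; congr (S _ _)%:M; apply/val_inj.
(* Congruence by B clears the first row and column of S; the Schur complement Sc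
   is again positive definite. *)
pose B : 'M[R]_(1 + p) := block_mx 1%:M 0 (- s^-1 *: v) 1%:M.
pose Sc := S' - s^-1 *: (v *m v^T).
have BSB : B *m S1 *m B^T = block_mx s%:M 0 0 Sc.
  rewrite S1E /B tr_block_mx !trmx1 !trmx0 !mulmx_block.
  rewrite !mul1mx !mul0mx !addr0 !mulmx1 !mulmx0 !addr0.
  have s1 : - s^-1 *: v *m s%:M + v = 0.
    rewrite mul_mx_scalar scalerA mulrN divff ?gt_eqF//.
    by rewrite scaleN1r addNr.
  rewrite s1 mul0mx add0r linearZ/= -scalemxAr mul_scalar_mx scalerA mulNr.
  rewrite mulVf ?gt_eqF// scaleN1r addNr; congr block_mx.
  by rewrite -scalemxAl addrC scaleNr.
have [] := IH Sc.
  split; first by rewrite /Sc linearB linearZ/= trmx_mul trmxK symS'.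
  move=> w w0; pose w1 : 'cV[R]_(1 + p) := B^T *m col_mx 0 w.
  have : 0 < (w1^T *m S1 *m w1) 0 0.
    apply: posS; apply: contra w0 => /eqP.
    rewrite /w1 /B tr_block_mx mul_block_col !mulmx0 !add0r trmx1 mul1mx.
    by move=> /(congr1 (@dsubmx R 1 p 1)); rewrite col_mxKd linear0 => ->.
  have -> : w1^T *m S1 *m w1 = (col_mx 0 w)^T *m (B *m S1 *m B^T) *m col_mx 0 w.
    by rewrite /w1 trmx_mul trmxK !mulmxA.
  rewrite BSB tr_col_mx trmx0 mul_row_block !mul0mx !mulmx0 !add0r.
  by rewrite mul_row_col mul0mx add0r.
move=> A' hA'.
pose C : 'M[R]_(1 + p) := block_mx (Num.sqrt s)^-1%:M 0 0 A'.
exists (C *m B).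
have -> : C *m B *m S *m (C *m B)^T = C *m (B *m S1 *m B^T) *m C^T.
  by rewrite trmx_mul !mulmxA.
rewrite BSB /C tr_block_mx !trmx0 !mulmx_block tr_scalar_mx.
rewrite !mul0mx !mulmx0 !addr0 !add0r !mul0mx hA' -!scalar_mxM.
rewrite mulrAC -invfM -expr2 sqr_sqrtr ?ltW// mulVf ?gt_eqF//.
by rewrite -scalar_mx_block.
Qed.

Lemma invmx_whitening (p : nat) (S A : 'M[R]_p) :
  A *m S *m A^T = 1%:M -> invmx S = A^T *m A.
Proof.
move=> h; have ASA : S *m (A^T *m A) = 1%:M.
  by rewrite mulmxA; apply: mulmx1C; rewrite mulmxA.
have Su : S \in unitmx by case: (mulmx1_unit ASA).
by rewrite -[LHS]mulmx1 -ASA mulKmx.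
Qed.

Definition vdot (p : nat) (u v : 'cV[R]_p) : R := \sum_(l < p) u l 0 * v l 0.

Lemma qf_whitening (p : nat) (S A : 'M[R]_p) (u v : 'cV[R]_p) :
  A *m S *m A^T = 1%:M -> qf S u v = vdot (A *m u) (A *m v).
Proof.
move=> h; rewrite /qf (invmx_whitening h) -!mulmxA mulmxA -trmx_mul mxE.
by apply: eq_bigr => l _; rewrite mxE.
Qed.

Lemma qfDl (p : nat) (S : 'M[R]_p) u v w : qf S (u + v) w = qf S u w + qf S v w.
Proof. by rewrite /qf linearD/= !mulmxDl mxE. Qed.

Lemma qfDr (p : nat) (S : 'M[R]_p) u v w : qf S w (u + v) = qf S w u + qf S w v.
Proof. by rewrite /qf mulmxDr mxE. Qed.

Lemma qfZl (p : nat) (S : 'M[R]_p) a u w : qf S (a *: u) w = a * qf S u w.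
Proof. by rewrite /qf linearZ/= -!scalemxAl mxE. Qed.

Lemma qfZr (p : nat) (S : 'M[R]_p) a u w : qf S w (a *: u) = a * qf S w u.
Proof. by rewrite /qf -scalemxAr mxE. Qed.

Lemma qfNl (p : nat) (S : 'M[R]_p) u w : qf S (- u) w = - qf S u w.
Proof. by rewrite -scaleN1r qfZl mulN1r. Qed.

Lemma qfNr (p : nat) (S : 'M[R]_p) u w : qf S w (- u) = - qf S w u.
Proof. by rewrite -scaleN1r qfZr mulN1r. Qed.

Lemma qfC (p : nat) (S : 'M[R]_p) u v : spd S -> qf S u v = qf S v u.
Proof.
move=> /spd_whitening[A hA]; rewrite !(qf_whitening _ _ hA).
by apply: eq_bigr => l _; rewrite mulrC.
Qed.

End LinearAlgebra.

(** * Independence *)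

Section Independence.
Context {d : measure_display} {T : measurableType d} {R : realType}.
Variable P : probability T R.

Lemma g_sigma_algebra_indep (G : set (set T)) (B : set T) :
    G `<=` measurable -> G setT -> setI_closed G -> measurable B ->
    (forall A, G A -> P (A `&` B) = (P A * P B)%E) ->
  forall A, <<s G >> A -> P (A `&` B) = (P A * P B)%E.
Proof.
move=> Gm GT GI mB GB A sA.
have PB0 : 0 <= fine (P B) by exact: fine_ge0.
have mscE C : mscale (NngNum PB0) P C = (P C * P B)%E.
  by rewrite /mscale/= muleC fineK ?fin_num_measure.
rewrite -mscE.
apply: (g_sigma_algebra_measure_unique G Gm (fun=> setT) _ _ (mrestr P mB)) => //.
- by apply/seteqP; split => // x _; exists 0%N.
- by move=> C GC; rewrite /= mscE -GB.
- by move=> _; rewrite /= /mrestr setTI ltey_eq fin_num_measure.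
Qed.

Definition indep_rv (U V : T -> R) := forall A B, measurable A -> measurable B ->
  P (U @^-1` A `&` V @^-1` B) = (P (U @^-1` A) * P (V @^-1` B))%E.

Lemma g_sigma_algebra_indep_rv (G1 G2 : set (set T)) (U V : T -> R) :
    G1 `<=` measurable -> G1 setT -> setI_closed G1 ->
    G2 `<=` measurable -> G2 setT -> setI_closed G2 ->
    (forall A B, G1 A -> G2 B -> P (A `&` B) = (P A * P B)%E) ->
    @measurable_fun _ _ (g_sigma_algebraType G1) _ setT U ->
    @measurable_fun _ _ (g_sigma_algebraType G2) _ setT V ->
  indep_rv U V.
Proof.
move=> G1m G1T G1I G2m G2T G2I GP mU mV A B mA mB.
have sUA : <<s G1 >> (U @^-1` A) by rewrite -[X in <<s _ >> X]setTI; exact: mU.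
have sVB : <<s G2 >> (V @^-1` B) by rewrite -[X in <<s _ >> X]setTI; exact: mV.
have sG1 := smallest_sub (@sigma_algebra_measurable _ T) G1m.
apply: (g_sigma_algebra_indep G1m) => // [|A' GA'].
  exact: (smallest_sub (@sigma_algebra_measurable _ T) G2m).
rewrite setIC muleC; apply: (g_sigma_algebra_indep G2m) => // [|B' GB'].
  exact: G1m.
by rewrite setIC muleC GP.
Qed.

Lemma expectation_indep (U V : T -> R) :
    P.-integrable setT (EFin \o U) -> P.-integrable setT (EFin \o V) ->
    P.-integrable setT (EFin \o (U \* V)) -> indep_rv U V ->
  (\int[P]_t (U t * V t) = (\int[P]_t U t) * (\int[P]_t V t))%R.
Proof.
move=> iU iV iUV UV.
have mU : measurable_fun setT U by apply/measurable_EFinP; exact: measurable_int iU.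
have mV : measurable_fun setT V by apply/measurable_EFinP; exact: measurable_int iV.
pose U' : {mfun T >-> R} := HB.pack U (isMeasurableFun.Build _ _ _ _ U mU).
pose V' : {mfun T >-> R} := HB.pack V (isMeasurableFun.Build _ _ _ _ V mV).
pose W t := (U t, V t).
have mW : measurable_fun setT W by exact: measurable_fun_pair.
pose W' : {mfun T >-> (R * R)%type} :=
  HB.pack W (isMeasurableFun.Build _ _ _ _ W mW).
pose m1 := distribution P U'; pose m2 := distribution P V'.
pose m12 := distribution P W'.
have m12E X : measurable X -> (m1 \x m2)%E X = m12 X.
  apply: product_measure_unique => A B mA mB.
  by rewrite -UV.
pose f (z : R * R) := (z.1 * z.2)%:E.
have mf : measurable_fun setT f by exact/measurable_EFinP/measurable_funM.
have if12 : m12.-integrable setT f.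
  by apply: integrable_pushforward => //; exact: iUV.
have iff : (m1 \x m2)%E.-integrable setT f.
  move/integrableP : if12 => [_ ifoo]; apply/integrableP; split => //.
  by rewrite (eq_measure_integral m12)// => A mA _; exact: m12E.
have EV : (\int[m2]_y (y%:E) = (\int[P]_t V t)%:E)%E.
  rewrite integral_distribution//.
  rewrite fineK//; exact: integrable_fin_num.
have EU : (\int[m1]_y (y%:E) = (\int[P]_t U t)%:E)%E.
  rewrite integral_distribution//.
  rewrite fineK//; exact: integrable_fin_num.
have idV : m2.-integrable setT EFin.
  by apply: integrable_pushforward => //.
have idU : m1.-integrable setT EFin.
  by apply: integrable_pushforward => //.
apply: EFin_inj; rewrite fineK; last exact: integrable_fin_num.
transitivity (\int[m12]_z f z)%E; first by rewrite integral_distribution.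
transitivity (\int[m1 \x m2]_z f z)%E.
  by apply: eq_measure_integral => A mA _; exact: (esym (m12E A mA)).
rewrite -integral12_prod_meas1// /fubini_F/=.
under eq_integral.
  move=> x _; rewrite /f/=; under eq_integral do rewrite EFinM.
  rewrite integralZl//= EV.
  over.
by rewrite /= integralZr// EU EFinM.
Qed.

End Independence.

Section RandomVectors.
Context {d : measure_display} {T : measurableType d} {R : realType}.
Variable P : probability T R.
Variables (I : finType) (p : nat) (X : I -> T -> 'cV[R]_p).
Hypothesis mX : forall i, rvec (X i).
Hypothesis indepX : indep_vecs P X.

Let rect (J : pred I) (B : I -> 'I_p -> set R) : set T :=
  [set t | forall i, J i -> forall l, B i l (X i t l 0)].

Definition rectangles (J : pred I) : set (set T) :=
  [set A | exists2 B, (forall i l, measurable (B i l)) & A = rect J B].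

Lemma rectangles_measurable J : rectangles J `<=` measurable.
Proof.
move=> _ [B mB ->].
rewrite [X in measurable X](_ : _ = \bigcap_(i in [set i | J i])
    \bigcap_(l in [set: 'I_p]) [set t | B i l (X i t l 0)]); last first.
  by apply/seteqP; split => t /= h i Ji l; [move=> _|]; apply: h.
apply: fin_bigcap_measurable => // i _; apply: fin_bigcap_measurable => // l _.
by rewrite -[X in measurable X]setTI; apply: mX.
Qed.

Lemma rectangles_setT J : rectangles J setT.
Proof. by exists (fun _ _ => setT) => //; apply/seteqP. Qed.

Lemma rectangles_setI J : setI_closed (rectangles J).
Proof.
move=> _ _ [B mB ->] [C mC ->]; exists (fun i l => B i l `&` C i l).
  by move=> i l; exact: measurableI.
apply/seteqP; split => t /=.
  by move=> [hB hC] i Ji l; split; [exact: hB|exact: hC].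
by move=> h; split => i Ji l; case: (h i Ji l).
Qed.

Let rect_prod J B : (forall i l, measurable (B i l)) ->
  P (rect J B) =
  (\prod_i P [set t | forall l, (if J i then B i l else setT) (X i t l ord0)])%E.
Proof.
move=> mB.
rewrite -(indepX (B := fun i l => if J i then B i l else setT)); last first.
  by move=> i l; case: ifP.
congr (P _); apply/seteqP; split => t /= h i.
  by move=> _ l; have := h i; case: (J i) => // /(_ isT l).
by move=> Ji l; have := h i Logic.I l; rewrite /= Ji.
Qed.

Lemma rectangles_indep J1 J2 A B : (forall i, ~~ (J1 i && J2 i)) ->
  rectangles J1 A -> rectangles J2 B -> P (A `&` B) = (P A * P B)%E.
Proof.
move=> J12 [C mC ->] [D mD ->].
have -> : rect J1 C `&` rect J2 D =
    rect (fun i => J1 i || J2 i) (fun i l => if J1 i then C i l else D i l).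
  apply/seteqP; split => t /=.
    move=> [hC hD] i /orP[Ji|Ji] l; first by rewrite Ji; exact: hC.
    by have := J12 i; rewrite Ji andbT => /negbTE ->; exact: hD.
  move=> h; split => i Ji l.
    by have := h i; rewrite Ji; exact.
  have := h i; rewrite Ji orbT => /(_ isT l).
  by have := J12 i; rewrite Ji andbT => /negbTE ->.
rewrite !rect_prod//; last by move=> i l; case: ifP.
rewrite -big_split/=; apply: eq_bigr => i _.
have T1 : P [set t | forall l : 'I_p, setT (X i t l ord0)] = 1%E.
  by rewrite -(probability_setT P); congr (P _); apply/seteqP.
by have := J12 i; case: (J1 i) => /=; case: (J2 i) => //= _;
  rewrite T1 ?mule1 ?mul1e.
Qed.

(* U is a measurable function of the vectors X i with i in J. *)
Definition dep (J : pred I) (U : T -> R) :=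
  @measurable_fun _ _ (g_sigma_algebraType (rectangles J)) _ setT U.

Lemma dep_coord (J : pred I) i l : J i -> dep J (fun t => X i t l 0).
Proof.
move=> Ji _ B mB; apply: sub_sigma_algebra.
exists (fun i' l' => if (i' == i) && (l' == l) then B else setT).
  by move=> i' l'; case: ifP.
rewrite setTI; apply/seteqP; split => t /=.
  by move=> h i' _ l'; case: ifP => // /andP[/eqP -> /eqP ->].
by move=> /(_ i Ji l); rewrite !eqxx.
Qed.

Lemma depD J U V : dep J U -> dep J V -> dep J (fun t => U t + V t).
Proof. by move=> ? ?; exact: measurable_funD. Qed.

Lemma depM J U V : dep J U -> dep J V -> dep J (fun t => U t * V t).
Proof. by move=> ? ?; exact: measurable_funM. Qed.

Lemma dep_cst J c : dep J (cst c).
Proof. exact: measurable_cst. Qed.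

Lemma dep_sum J (K : finType) (U : K -> T -> R) :
  (forall k, dep J (U k)) -> dep J (fun t => \sum_k U k t).
Proof.
move=> dU; rewrite /dep; elim: (index_enum K) => [|k s IH].
  by under eq_fun do rewrite big_nil; exact: dep_cst.
by under eq_fun do rewrite big_cons; apply: depD.
Qed.

Lemma dep_indep J1 J2 U V : (forall i, ~~ (J1 i && J2 i)) ->
  dep J1 U -> dep J2 V -> indep_rv P U V.
Proof.
move=> J12 dU dV.
apply: (@g_sigma_algebra_indep_rv _ _ _ P (rectangles J1) (rectangles J2)) => //;
  do ?[exact: rectangles_measurable|exact: rectangles_setT|exact: rectangles_setI].
by move=> A B; exact: rectangles_indep.
Qed.

End RandomVectors.

(** * Second moments of Gram matrices *)

Section AllMoments.
Context {d : measure_display} {T : measurableType d} {R : realType}.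
Variable P : probability T R.

(* Unlike plain integrability, having all moments is stable under products. *)
Definition allmom (f : T -> R) := measurable_fun setT f /\
  forall n, P.-integrable setT (fun t => (`|f t| ^+ n)%:E).

Lemma allmom_integrable f : allmom f -> P.-integrable setT (EFin \o f).
Proof.
move=> [mf /(_ 1%N)]; apply: le_integrable => //; first exact/measurable_EFinP.
by move=> t _; rewrite /= lee_fin expr1 normr_id.
Qed.

Let le_pow (f g : T -> R) n : measurable_fun setT f ->
    P.-integrable setT (EFin \o g) -> (forall t, `|f t| ^+ n <= g t) ->
  P.-integrable setT (fun t => (`|f t| ^+ n)%:E).
Proof.
move=> mf ig fg; apply: le_integrable ig => //.
  by apply/measurable_EFinP/measurable_funX; exact: measurableT_comp.
move=> t _; rewrite /= lee_fin ger0_norm ?exprn_ge0//.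
exact: le_trans (fg t) (ler_norm _).
Qed.

Lemma allmom_cst c : allmom (cst c).
Proof.
split=> [|n]; first exact: measurable_cst.
exact: (@finite_measure_integrable_cst _ _ _ P setT (`|c| ^+ n)).
Qed.

Lemma allmomD f g : allmom f -> allmom g -> allmom (fun t => f t + g t).
Proof.
move=> [mf hf] [mg hg]; split=> [|n]; first exact: measurable_funD.
apply: (@le_pow _ (fun t => 2 ^+ n * (`|f t| ^+ n + `|g t| ^+ n))).
- exact: measurable_funD.
- have := integrableZl measurableT (2 ^+ n)
    (integrableD measurableT (hf n) (hg n)).
  exact.
- move=> t; move: (`|f t|) (`|g t|) (normr_ge0 (f t)) (normr_ge0 (g t))
    (ler_normD (f t) (g t)) => a b a0 b0 ab.
  apply: (@le_trans _ _ ((2 * Num.max a b) ^+ n)).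
    rewrite lerXn2r ?nnegrE ?mulr_ge0 ?le_max ?a0//.
    apply: le_trans ab _; rewrite mulr_natl mulr2n.
    by rewrite lerD// le_max lexx ?orbT.
  rewrite exprMn ler_pM2l ?exprn_gt0//.
  by case: (leP a b) => _; rewrite ?lerDl ?lerDr exprn_ge0.
Qed.

Lemma allmomM f g : allmom f -> allmom g -> allmom (fun t => f t * g t).
Proof.
move=> [mf hf] [mg hg]; split=> [|n]; first exact: measurable_funM.
apply: (@le_pow _ (fun t => `|f t| ^+ (n + n) + `|g t| ^+ (n + n))).
- exact: measurable_funM.
- have := integrableD measurableT (hf (n + n)%N) (hg (n + n)%N); exact.
- move=> t; rewrite normrM exprMn !exprD.
  move: (`|f t| ^+ n) (`|g t| ^+ n) => a b.
  have := sqr_ge0 (a - b); have := sqr_ge0 (a + b); nra.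
Qed.

Lemma allmom_sum (K : finType) (f : K -> T -> R) :
  (forall k, allmom (f k)) -> allmom (fun t => \sum_k f k t).
Proof.
move=> af; elim: (index_enum K) => [|k s IH].
  by under eq_fun do rewrite big_nil; exact: allmom_cst.
by under eq_fun do rewrite big_cons; apply: allmomD.
Qed.

Definition Ex (f : T -> R) : R := \int[P]_t f t.

Lemma eq_Ex f g : f =1 g -> Ex f = Ex g.
Proof. by move=> /funext ->. Qed.

Lemma Ex_cst c : Ex (cst c) = c.
Proof.
have := Rintegral_cst P measurableT c.
by have /= -> := probability_setT P; rewrite mulr1.
Qed.

Lemma ExD f g : allmom f -> allmom g -> Ex (fun t => f t + g t) = Ex f + Ex g.
Proof. by move=> af ag; rewrite /Ex RintegralD//; exact: allmom_integrable. Qed.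

Lemma ExZ c f : allmom f -> Ex (fun t => c * f t) = c * Ex f.
Proof. by move=> af; rewrite /Ex RintegralZl//; exact: allmom_integrable. Qed.

Lemma Ex_le f g : allmom f -> allmom g -> (forall t, f t <= g t) -> Ex f <= Ex g.
Proof.
move=> af ag fg; rewrite /Ex le_Rintegral//; exact: allmom_integrable.
Qed.

Lemma Ex_sum (K : finType) (f : K -> T -> R) :
  (forall k, allmom (f k)) -> Ex (fun t => \sum_k f k t) = \sum_k Ex (f k).
Proof.
move=> af; suff [] : allmom (fun t => \sum_k f k t) /\
  Ex (fun t => \sum_k f k t) = \sum_k Ex (f k) by [].
elim: (index_enum K) => [|k s [IHa IH]].
  under eq_fun do rewrite big_nil; split; first exact: allmom_cst.
  by rewrite big_nil; exact: Ex_cst.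
have -> : (fun t => \sum_(i <- k :: s) f i t) = (fun t => f k t + \sum_(i <- s) f i t).
  by apply/funext => t; rewrite big_cons.
by split; [exact: allmomD|rewrite ExD// big_cons IH].
Qed.

Lemma Ex_sqr_sum (K : finType) (c : K -> R) (f : K -> T -> R) :
    (forall k, allmom (f k)) ->
  Ex (fun t => (\sum_k c k * f k t) ^+ 2) =
  \sum_i \sum_j c i * c j * Ex (fun t => f i t * f j t).
Proof.
move=> af.
transitivity (Ex (fun t => \sum_i \sum_j c i * c j * (f i t * f j t))).
  apply: eq_Ex => t; rewrite expr2 mulr_suml; apply: eq_bigr => i _.
  by rewrite mulr_sumr; apply: eq_bigr => j _; rewrite mulrACA.
have a2 i j : allmom (fun t => f i t * f j t) by exact: allmomM.
have a3 i j : allmom (fun t => c i * c j * (f i t * f j t)).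
  by apply: allmomM => //; exact: allmom_cst.
rewrite Ex_sum => [|i]; last exact: allmom_sum.
apply: eq_bigr => i _; rewrite Ex_sum//.
by apply: eq_bigr => j _; rewrite ExZ.
Qed.

End AllMoments.

Section WhitenedSample.
Context {d : measure_display} {T : measurableType d} {R : realType}.
Variable P : probability T R.
Variables (I : finType) (p : nat) (X : I -> T -> 'cV[R]_p).
Hypothesis mX : forall i, rvec (X i).
Hypothesis indepX : indep_vecs P X.
Variable y : I -> 'I_p -> T -> R.
Hypothesis dep_y : forall (J : pred I) k a, J k -> dep X J (y k a).
Hypothesis mom_y : forall k a, allmom P (y k a).
Hypothesis Ex_y : forall k a, Ex P (y k a) = 0.
Hypothesis Ex_yy : forall k a b,
  Ex P (fun t => y k a t * y k b t) = (a == b)%:R.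
Variable C : R.
Hypothesis Ex_y4 : forall k a, Ex P (fun t => (y k a t * y k a t - 1) ^+ 2) <= C.

Lemma Ex_indep J1 J2 U V : (forall i, ~~ (J1 i && J2 i)) ->
    allmom P U -> allmom P V -> dep X J1 U -> dep X J2 V ->
  Ex P (fun t => U t * V t) = Ex P U * Ex P V.
Proof.
move=> J12 aU aV dU dV; apply: expectation_indep.
- exact: allmom_integrable.
- exact: allmom_integrable.
- by apply: allmom_integrable; exact: allmomM.
- exact: (dep_indep mX indepX J12).
Qed.

Definition gram k l t : R := \sum_a y k a t * y l a t - p%:R * (k == l)%:R.

Lemma gramC k l : gram k l = gram l k.
Proof.
apply/funext => t; rewrite /gram eq_sym; congr (_ - _).
by apply: eq_bigr => a _; rewrite mulrC.
Qed.

Lemma allmom_gram k l : allmom P (gram k l).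
Proof.
by apply: allmomD; [apply: allmom_sum => a; exact: allmomM|exact: allmom_cst].
Qed.

Lemma dep_gram (J : pred I) k l : J k -> J l -> dep X J (gram k l).
Proof.
move=> Jk Jl; apply: depD; last exact: dep_cst.
by apply: dep_sum => a; apply: depM; exact: dep_y.
Qed.

Lemma gram_neq k l t : k != l -> gram k l t = \sum_a y k a t * y l a t.
Proof. by move=> /negbTE kl; rewrite /gram kl mulr0 subr0. Qed.

Lemma gram_diag k t : gram k k t = \sum_a (y k a t * y k a t - 1).
Proof.
by rewrite /gram eqxx mulr1 sumrB sumr_const card_ord.
Qed.

Lemma Ex_gram k l : Ex P (gram k l) = 0.
Proof.
rewrite ExD; [|by apply: allmom_sum => a; exact: allmomM|exact: allmom_cst].
rewrite Ex_cst Ex_sum => [|a]; last exact: allmomM.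
have [->|kl] := eqVneq k l.
  by under eq_bigr do rewrite Ex_yy eqxx; rewrite sumr_const card_ord mulr1 subrr.
rewrite mulr0 subr0 big1// => a _.
rewrite (@Ex_indep (pred1 k) (predC1 k))// ?Ex_y ?mul0r//.
- by move=> i /=; case: eqP.
- by apply: dep_y => /=.
- by apply: dep_y => /=; rewrite eq_sym.
Qed.

Let gram0 k l k' l' : k != l -> k != k' -> k != l' ->
  Ex P (fun t => gram k l t * gram k' l' t) = 0.
Proof.
move=> kl kk' kl'.
transitivity (Ex P (fun t => \sum_a y k a t * (y l a t * gram k' l' t))).
  apply: eq_Ex => t; rewrite gram_neq// mulr_suml.
  by apply: eq_bigr => a _; rewrite mulrA.
have ag := allmom_gram.
rewrite Ex_sum => [|a]; last by apply: allmomM => //; exact: allmomM.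
rewrite big1// => a _.
rewrite (@Ex_indep (pred1 k) (predC1 k))// ?Ex_y ?mul0r//.
- by move=> i /=; case: eqP.
- exact: allmomM.
- by apply: dep_y => /=.
- apply: depM; first by apply: dep_y => /=; rewrite eq_sym.
  by apply: dep_gram => /=; rewrite eq_sym.
Qed.

Lemma gram_uncorrelated k l k' l' : (k', l') != (k, l) -> (k', l') != (l, k) ->
  Ex P (fun t => gram k l t * gram k' l' t) = 0.
Proof.
rewrite -!pair_eqE /pair_eq/= => h1 h2.
have C' : Ex P (fun t => gram k l t * gram k' l' t) =
  Ex P (fun t => gram k' l' t * gram k l t) by apply: eq_Ex => t; rewrite mulrC.
have [kl|kl] := eqVneq k l; have [kl'|kl'] := eqVneq k' l'.
- subst l l'; have kk' : k' != k by move: h1; rewrite andbb.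
  rewrite (@Ex_indep (pred1 k) (predC1 k)) ?Ex_gram ?mul0r//.
  + by move=> i /=; case: eqP.
  + exact: allmom_gram.
  + exact: allmom_gram.
  + by apply: dep_gram => /=.
  + by apply: dep_gram => /=.
- subst l; rewrite C'; have [k'k|k'k] := eqVneq k' k; last exact: gram0.
  by subst k'; rewrite (gramC k l'); apply: gram0; rewrite eq_sym.
- subst l'; have [kk'|kk'] := eqVneq k k'; last exact: gram0.
  by subst k'; rewrite (gramC k l); apply: gram0; rewrite eq_sym.
- have [kk'|kk'] := eqVneq k k'.
    subst k'; rewrite (gramC k l); apply: gram0; rewrite 1?[l == k]eq_sym//.
    by move: h1; rewrite eqxx/= eq_sym.
  have [kl''|kl''] := eqVneq k l'; last exact: gram0.
  subst l'; rewrite (gramC k l); apply: gram0; rewrite 1?[l == k]eq_sym//.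
  by move: h2; rewrite eqxx andbT eq_sym.
Qed.

Definition gram_bound (k l : I) : R := if k == l then C * p%:R ^+ 2 else p%:R.

Lemma Ex_gram_sqr k l :
  Ex P (fun t => gram k l t * gram k l t) <= gram_bound k l.
Proof.
rewrite /gram_bound; have [<-|kl] := eqVneq k l.
  pose u a t := y k a t * y k a t - 1.
  have au a : allmom P (u a) by apply: allmomD; [exact: allmomM|exact: allmom_cst].
  have au2 a : allmom P (fun t => u a t ^+ 2) by exact: allmomM.
  apply: (@le_trans _ _ (Ex P (fun t => p%:R * \sum_a u a t ^+ 2))).
    apply: Ex_le.
    - by apply: allmomM; exact: allmom_gram.
    - by apply: allmomM; [exact: allmom_cst|exact: allmom_sum].
    move=> t; rewrite gram_diag -/(u _ t) mulr_suml.
    apply: (@le_trans _ _ (\sum_(a < p) \sum_(b < p) (u a t ^+ 2 + u b t ^+ 2) / 2)).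
      apply: ler_sum => a _; rewrite mulr_sumr; apply: ler_sum => b _.
      rewrite -/(u a t) -/(u b t); have := sqr_ge0 (u a t - u b t); lra.
    under eq_bigr do rewrite -mulr_suml big_split/= sumr_const card_ord.
    rewrite -mulr_suml big_split/= sumr_const card_ord -sumrMnl.
    by rewrite sumrMnl mulr_natl; lra.
  rewrite ExZ; last exact: allmom_sum.
  rewrite Ex_sum// expr2 mulrCA ler_wpM2l//.
  apply: le_trans (_ : \sum_(a < p) C <= _).
    by apply: ler_sum => a _; exact: Ex_y4.
  by rewrite sumr_const card_ord mulr_natr.
have ayy k' a b : allmom P (fun t => y k' a t * y k' b t) by exact: allmomM.
rewrite le_eqVlt; apply/orP; left; apply/eqP.
transitivity (Ex P (fun t => \sum_a \sum_b
    (y k a t * y k b t) * (y l a t * y l b t))).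
  apply: eq_Ex => t; rewrite gram_neq// mulr_suml; apply: eq_bigr => a _.
  by rewrite mulr_sumr; apply: eq_bigr => b _; rewrite mulrACA.
have a4 a b : allmom P (fun t => (y k a t * y k b t) * (y l a t * y l b t)).
  exact: allmomM.
rewrite Ex_sum => [|a]; last exact: allmom_sum.
have E2 a : Ex P (fun t => \sum_b (y k a t * y k b t) * (y l a t * y l b t)) = 1.
  rewrite Ex_sum// (bigD1 a)//= big1 ?addr0 => [|b ba].
    rewrite (@Ex_indep (pred1 k) (predC1 k))// ?Ex_yy ?eqxx ?mulr1//.
    - by move=> i /=; case: eqP.
    - by apply: depM; apply: dep_y => /=.
    - by apply: depM; apply: dep_y => /=; rewrite eq_sym.
  rewrite (@Ex_indep (pred1 k) (predC1 k))// ?Ex_yy.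
  - by rewrite eq_sym (negbTE ba) mul0r.
  - by move=> i /=; case: eqP.
  - by apply: depM; apply: dep_y => /=.
  - by apply: depM; apply: dep_y => /=; rewrite eq_sym.
by under eq_bigr do rewrite E2; rewrite sumr_const card_ord.
Qed.

(* Only the pairs w = z and w = swap z contribute to the expanded square. *)
Lemma gram_sum_bound (c : I * I -> R) :
  Ex P (fun t => (\sum_z c z * gram z.1 z.2 t) ^+ 2) <=
  2 * \sum_z c z ^+ 2 * gram_bound z.1 z.2.
Proof.
rewrite Ex_sqr_sum; last by move=> z; exact: allmom_gram.
pose sw (z : I * I) := (z.2, z.1).
have swK : involutive sw by case.
have Esqr0 k l : 0 <= Ex P (fun t => gram k l t * gram k l t).
  by apply: Rintegral_ge0 => t _; rewrite -expr2 sqr_ge0.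
have M0 z : 0 <= gram_bound z.1 z.2 := le_trans (Esqr0 z.1 z.2) (Ex_gram_sqr _ _).
have Msw z : gram_bound (sw z).1 (sw z).2 = gram_bound z.1 z.2.
  by rewrite /gram_bound/= eq_sym.
apply: (@le_trans _ _ (\sum_z \sum_w (c z ^+ 2 + c w ^+ 2) / 2 *
    gram_bound z.1 z.2 * ((w == z)%:R + (w == sw z)%:R))).
  apply: ler_sum => z _; apply: ler_sum => w _.
  have czw : c z * c w <= (c z ^+ 2 + c w ^+ 2) / 2.
    have := sqr_ge0 (c z - c w); lra.
  have s0 : 0 <= (c z ^+ 2 + c w ^+ 2) / 2.
    by rewrite divr_ge0// addr_ge0 ?sqr_ge0.
  set e := Ex P _.
  have [[e0 /andP[e1 e2]]|ezw] :
      ((w == z) || (w == sw z)) /\ 0 <= e <= gram_bound z.1 z.2 \/ e = 0.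
    have Ez : 0 <= Ex P (fun t => gram z.1 z.2 t * gram z.1 z.2 t) <=
        gram_bound z.1 z.2 by rewrite Ex_gram_sqr Esqr0.
    rewrite /e; have [->|wz] := eqVneq w z; first by left.
    have [->|wsz] := eqVneq w (sw z); first by left; rewrite /sw/= (gramC z.2).
    right; apply: gram_uncorrelated.
      by case: (z) (w) wz => ? ? [].
    by case: (z) (w) wsz => ? ? [].
  - apply: (@le_trans _ _ ((c z ^+ 2 + c w ^+ 2) / 2 * gram_bound z.1 z.2)).
      apply: (@le_trans _ _ ((c z ^+ 2 + c w ^+ 2) / 2 * e)).
        by rewrite ler_wpM2r.
      by rewrite ler_wpM2l.
    apply: ler_peMr; first exact: mulr_ge0.
    by case/orP: e0 => ->; rewrite ?lerDl ?lerDr.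
  - by rewrite ezw mulr0; apply: mulr_ge0; [exact: mulr_ge0|exact: addr_ge0].
have pick (F : I * I -> R) z : \sum_w F w * (w == z)%:R = F z.
  rewrite (bigD1 z)//= eqxx mulr1 big1 ?addr0// => w /negbTE ->.
  by rewrite mulr0.
under eq_bigr => z _.
  under eq_bigr do rewrite mulrDr.
  rewrite big_split/= !pick.
  over.
rewrite big_split/=.
under [X in _ + X]eq_bigr => z _ do rewrite mulrDl mulrDl.
rewrite big_split/=.
rewrite [X in _ + (_ + X)](reindex_inj (inv_inj swK))/=.
under [X in _ + (_ + X)]eq_bigr => z _ do rewrite swK Msw.
rewrite -!big_split/= mulr_sumr; apply: ler_sum => z _; lra.
Qed.

Lemma linear_sum_sqr (w : I -> R) (u : 'I_p -> R) :
  Ex P (fun t => (\sum_k w k * \sum_a u a * y k a t) ^+ 2) =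
  (\sum_k w k ^+ 2) * \sum_a u a ^+ 2.
Proof.
have aL k : allmom P (fun t => \sum_a u a * y k a t).
  by apply: allmom_sum => a; apply: allmomM => //; exact: allmom_cst.
have dL (J : pred I) k : J k -> dep X J (fun t => \sum_a u a * y k a t).
  move=> Jk; apply: dep_sum => a; apply: depM; first exact: dep_cst.
  exact: dep_y.
have EL k : Ex P (fun t => \sum_a u a * y k a t) = 0.
  rewrite Ex_sum => [|a]; last by apply: allmomM => //; exact: allmom_cst.
  by rewrite big1// => a _; rewrite ExZ// Ex_y mulr0.
rewrite Ex_sqr_sum// mulr_suml; apply: eq_bigr => k _.
rewrite (bigD1 k)//= big1 ?addr0 => [|l lk].
  rewrite -expr2; congr (_ * _).
  transitivity (Ex P (fun t => (\sum_a u a * y k a t) ^+ 2)).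
    by apply: eq_Ex => t; rewrite expr2.
  rewrite Ex_sqr_sum//; apply: eq_bigr => a _.
  rewrite (bigD1 a)//= big1 ?addr0 => [|b ba]; rewrite Ex_yy.
    by rewrite eqxx mulr1 expr2.
  by rewrite eq_sym (negbTE ba) mulr0.
rewrite (@Ex_indep (pred1 k) (predC1 k)) ?EL ?mul0r ?mulr0//.
- by move=> i /=; case: eqP.
- by apply: dL => /=.
- by apply: dL => /=.
Qed.

End WhitenedSample.

Section GaussianSample.
Context {d : measure_display} {T : measurableType d} {R : realType}.
Variable P : probability T R.

Section Law.
Notation RR := (measurableTypeR R).
Variables (W : T -> RR) (Q : probability RR R).
Hypothesis mW : measurable_fun setT W.
Hypothesis lawW : forall B : set RR, measurable B -> P (W @^-1` B) = Q B.

Lemma ge0_integral_law (f : RR -> R) : measurable_fun setT f ->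
  (forall x, 0 <= f x) ->
  (\int[P]_t (f (W t))%:E = \int[Q]_x (f x)%:E)%E.
Proof.
move=> mf f0; pose W' : {mfun T >-> RR} := HB.pack W (isMeasurableFun.Build _ _ _ _ W mW).
rewrite -(ge0_integral_distribution W' (f := EFin \o f)).
- by apply: eq_measure_integral => A mA _; exact: lawW.
- exact/measurable_EFinP.
- by move=> x; rewrite lee_fin.
Qed.

Lemma integrable_law (f : RR -> R) : measurable_fun setT f ->
  Q.-integrable setT (EFin \o f) -> P.-integrable setT (fun t => (f (W t))%:E).
Proof.
move=> mf /integrableP[_ ifoo]; apply/integrableP; split.
  by apply/measurable_EFinP; exact: measurableT_comp.
rewrite (ge0_integral_law (f := fun x => `|f x|))//.
exact: measurableT_comp.
Qed.

Lemma integral_law (f : RR -> R) : measurable_fun setT f ->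
  Q.-integrable setT (EFin \o f) ->
  (\int[P]_t (f (W t))%:E = \int[Q]_x (f x)%:E)%E.
Proof.
move=> mf iQ; pose W' : {mfun T >-> RR} := HB.pack W (isMeasurableFun.Build _ _ _ _ W mW).
rewrite -(integral_distribution (X := W') (f := EFin \o f)).
- by apply: eq_measure_integral => A mA _; exact: lawW.
- exact/measurable_EFinP.
- exact: integrable_law.
Qed.

End Law.

Section UnitForm.
Variables (p : nat) (X : T -> 'cV[R]_p) (mu : 'cV[R]_p) (S : 'M[R]_p).
Hypothesis gX : gaussian_vec P X mu S.
Variable v : 'cV[R]_p.
Hypothesis vSv : (v^T *m S *m v) 0 0 = 1.

Let W t := (v^T *m X t) 0 0.
Let m := (v^T *m mu) 0 0.

Let mW : measurable_fun setT W.
Proof.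
rewrite /W; under eq_fun do rewrite mxE.
have [mX _] := gX.
elim: (index_enum _) => [|l s IH].
  by under eq_fun do rewrite big_nil; exact: measurable_cst.
under eq_fun do rewrite big_cons; apply: measurable_funD => //.
by apply: measurable_funM => //; exact: mX.
Qed.

Let lawW B : measurable B -> P (W @^-1` B) = normal_prob m 1 B.
Proof.
move=> mB; have [_ /(_ v)] := gX; rewrite vSv sqrtr1; apply => //.
by apply/eqP => v0; move: vSv; rewrite v0 mulmx0 mxE => /esym/eqP; rewrite oner_eq0.
Qed.

Let mctr : measurable_fun setT (fun x : R => x - m).
Proof. exact: measurable_funB. Qed.

Lemma allmom_gaussian_form : allmom P (fun t => (v^T *m X t) 0 0 - (v^T *m mu) 0 0).
Proof.
split=> [|n]; first exact: measurable_funB.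
have := @integrable_law W (normal_prob m 1) mW lawW (fun x => `|x - m| ^+ n).
apply; first by apply: measurable_funX; exact: measurableT_comp.
exact: integrable_normal_moment.
Qed.

Lemma Ex_gaussian_form : Ex P (fun t => (v^T *m X t) 0 0 - (v^T *m mu) 0 0) = 0.
Proof.
rewrite /Ex /Rintegral (integral_law mW lawW (f := fun x => x - m))//.
  by rewrite integral_normal_centered.
have := integrable_normal_moment m 1.
apply: le_integrable => //; first exact/measurable_EFinP.
by move=> x _; rewrite /= lee_fin expr1 normr_id.
Qed.

Lemma Ex_gaussian_form_sqr :
  Ex P (fun t => ((v^T *m X t) 0 0 - (v^T *m mu) 0 0) ^+ 2) = 1.
Proof.
rewrite /Ex /Rintegral (ge0_integral_law mW lawW (f := fun x => (x - m) ^+ 2)).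
- by rewrite integral_normal_variance.
- exact: measurable_funX.
- by move=> x; rewrite sqr_ge0.
Qed.

Lemma Ex_gaussian_form_pow4 (C : R) :
  (forall m, (\int[normal_prob m 1]_x ((x - m) ^+ 4)%:E <= C%:E)%E) ->
  Ex P (fun t => ((v^T *m X t) 0 0 - (v^T *m mu) 0 0) ^+ 4) <= C.
Proof.
move=> hC; rewrite -lee_fin /Ex /Rintegral.
have p0 x : 0 <= (x - m) ^+ 4 :> R by rewrite exprn_even_ge0.
rewrite (ge0_integral_law mW lawW (f := fun x => (x - m) ^+ 4))//; last first.
  exact: measurable_funX.
have i0 : (0 <= \int[normal_prob m 1]_x ((x - m) ^+ 4)%:E)%E.
  by apply: integral_ge0 => x _; rewrite lee_fin.
rewrite fineK; first exact: hC.
by rewrite ge0_fin_numE//; exact: le_lt_trans (hC m) (ltry C).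
Qed.

End UnitForm.

Section Whitened.
Variables (I : finType) (p : nat) (X : I -> T -> 'cV[R]_p) (mu : I -> 'cV[R]_p).
Variables (S A : 'M[R]_p).
Hypothesis gX : forall k, gaussian_vec P (X k) (mu k) S.
Hypothesis whitenA : A *m S *m A^T = 1%:M.

Definition whitened k a t : R := (A *m (X k t - mu k)) a 0.

Let row_form k (b : 'cV[R]_p) t :
  \sum_a b a 0 * whitened k a t =
  ((A^T *m b)^T *m X k t) 0 0 - ((A^T *m b)^T *m mu k) 0 0.
Proof.
transitivity ((b^T *m (A *m (X k t - mu k))) 0 0).
  by rewrite [RHS]mxE; apply: eq_bigr => a _; rewrite [b^T _ _]mxE.
have -> : (A^T *m b)^T = b^T *m A by rewrite trmx_mul trmxK.
by rewrite mulmxA mulmxBr [LHS]mxE [X in _ + X]mxE.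
Qed.

Let unit_form (b : 'cV[R]_p) : (b^T *m b) 0 0 = 1 ->
  ((A^T *m b)^T *m S *m (A^T *m b)) 0 0 = 1.
Proof.
move=> b1; have -> : (A^T *m b)^T *m S *m (A^T *m b) =
    b^T *m (A *m S *m A^T) *m b by rewrite trmx_mul trmxK !mulmxA.
by rewrite whitenA mulmx1.
Qed.

Let delta_form k a t :
  whitened k a t = \sum_b (delta_mx a 0 : 'cV[R]_p) b 0 * whitened k b t.
Proof.
rewrite (bigD1 a)//= mxE !eqxx mul1r big1 ?addr0// => b /negbTE ba.
by rewrite mxE ba mul0r.
Qed.

Let delta_unit a :
  ((delta_mx a 0 : 'cV[R]_p)^T *m (delta_mx a 0 : 'cV[R]_p)) 0 0 = 1.
Proof. by rewrite trmx_delta mul_delta_mx mxE !eqxx. Qed.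

Let unit_delta a := unit_form (delta_unit a).

Lemma dep_whitened (J : pred I) k a : J k -> dep X J (whitened k a).
Proof.
move=> Jk; rewrite /whitened; under eq_fun do rewrite mxE.
apply: dep_sum => l; apply: depM; first exact: dep_cst.
under eq_fun do rewrite !mxE.
by apply: depD; [exact: dep_coord|exact: dep_cst].
Qed.

Let formE k (b : 'cV[R]_p) : (fun t => \sum_a b a 0 * whitened k a t) =
  (fun t => ((A^T *m b)^T *m X k t) 0 0 - ((A^T *m b)^T *m mu k) 0 0).
Proof. by apply/funext => t; rewrite row_form. Qed.

Lemma allmom_whitened k a : allmom P (whitened k a).
Proof.
rewrite (_ : whitened k a = fun t =>
    \sum_b (delta_mx a 0 : 'cV[R]_p) b 0 * whitened k b t).
  rewrite formE; exact (allmom_gaussian_form (gX k) (unit_delta a)).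
by apply/funext => t; exact: delta_form.
Qed.

Lemma Ex_whitened k a : Ex P (whitened k a) = 0.
Proof.
rewrite (eq_Ex P (delta_form k a)) formE.
exact (Ex_gaussian_form (gX k) (unit_delta a)).
Qed.

Let Ex_sqr_form k (b : 'cV[R]_p) : (b^T *m b) 0 0 = 1 ->
  Ex P (fun t => (\sum_a b a 0 * whitened k a t) ^+ 2) = 1.
Proof.
move=> b1; rewrite -[RHS](Ex_gaussian_form_sqr (gX k) (unit_form b1)).
by apply: eq_Ex => t; rewrite row_form.
Qed.

Let Ex_sqr k a : Ex P (fun t => whitened k a t * whitened k a t) = 1.
Proof.
rewrite -[RHS](Ex_sqr_form k (delta_unit a)).
by apply: eq_Ex => t; rewrite -delta_form expr2.
Qed.

Lemma Ex_whitened_mul k a b :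
  Ex P (fun t => whitened k a t * whitened k b t) = (a == b)%:R.
Proof.
have [->|ab] := eqVneq a b; first exact: Ex_sqr.
(* Polarization along the unit vector (e_a + e_b) / sqrt 2. *)
pose s : R := (Num.sqrt 2)^-1.
have s2 : s * s = 2^-1 by rewrite -invfM -expr2 sqr_sqrtr.
pose v : 'cV[R]_p := s *: (delta_mx a 0 + delta_mx b 0).
have v1 : (v^T *m v) 0 0 = 1.
  rewrite mxE (bigD1 a)//= (bigD1 b)/=; last by rewrite eq_sym.
  rewrite big1 ?addr0 => [|l /andP[/negbTE la /negbTE lb]]; last first.
    by rewrite !mxE la lb /= addr0 mulr0 mul0r.
  by rewrite !mxE !eqxx/= [b == a]eq_sym (negbTE ab) /= addr0 add0r mulr1 s2; field.
have aw k' a' : allmom P (whitened k' a') := allmom_whitened k' a'.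
have awm a' b' : allmom P (fun t => whitened k a' t * whitened k b' t).
  exact: allmomM.
have := Ex_sqr_form k v1.
rewrite (_ : Ex P _ = Ex P (fun t => 2^-1 * (whitened k a t * whitened k a t
    + (whitened k b t * whitened k b t + 2 * (whitened k a t * whitened k b t))))).
  rewrite ExZ; last first.
    apply: allmomD => //; apply: allmomD => //; apply: allmomM => //.
    exact: allmom_cst.
  have a2 : allmom P (fun t => 2 * (whitened k a t * whitened k b t)).
    by apply: allmomM => //; exact: allmom_cst.
  rewrite ExD//; last exact: allmomD.
  rewrite ExD// ExZ// !Ex_sqr => h.
  have -> : Ex P (fun t => whitened k a t * whitened k b t) = 0 by lra.
  by [].
apply: eq_Ex => t.
have -> : \sum_a0 v a0 0 * whitened k a0 t = s * (whitened k a t + whitened k b t).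
  rewrite (bigD1 a)//= (bigD1 b)/=; last by rewrite eq_sym.
  rewrite big1 ?addr0 => [|l /andP[/negbTE la /negbTE lb]]; last first.
    by rewrite !mxE la lb /= addr0 mulr0 mul0r.
  rewrite !mxE !eqxx/= [b == a]eq_sym (negbTE ab) /= addr0 add0r mulr1.
  by rewrite mulrDr.
by rewrite exprMn [s ^+ 2]expr2 s2; ring.
Qed.

Lemma Ex_whitened_pow4 (C : R) k a :
    (forall m, (\int[normal_prob m 1]_x ((x - m) ^+ 4)%:E <= C%:E)%E) ->
  Ex P (fun t => (whitened k a t * whitened k a t - 1) ^+ 2) <= C + 1.
Proof.
move=> hC; have aw := allmom_whitened k a.
have aw2 : allmom P (fun t => whitened k a t * whitened k a t) by exact: allmomM.
have aw4 : allmom P (fun t => whitened k a t ^+ 4).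
  rewrite (_ : (fun t => _) = fun t => (whitened k a t * whitened k a t) *
    (whitened k a t * whitened k a t)); first exact: allmomM.
  by apply/funext => t; rewrite -!expr2 -exprM.
apply: (@le_trans _ _ (Ex P (fun t => whitened k a t ^+ 4 + 1))).
  apply: Ex_le.
  - by apply: allmomM; apply: allmomD => //; exact: allmom_cst.
  - by apply: allmomD => //; exact: allmom_cst.
  - by move=> t; have := sqr_ge0 (whitened k a t); nra.
rewrite ExD//; last exact: allmom_cst.
rewrite Ex_cst lerD2r.
have := Ex_gaussian_form_pow4 (gX k) (unit_delta a) hC.
by rewrite (eq_Ex P (g := fun t => whitened k a t ^+ 4))// => t; rewrite -row_form -delta_form.
Qed.

End Whitened.

End GaussianSample.

(** * Convergence in probability *)

Section InProbability.
Context {d : measure_display} {T : measurableType d} {R : realType}.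
Variable P : probability T R.

(* Convergence in probability of f n to l is convergence of
   (n, t) |-> f n t to l along this filter, so that the limit calculus of the
   library applies to it. *)
Definition in_prob : set_system (nat * T) := [set E | forall e : R, 0 < e ->
  \forall n \near \oo, exists A : set T,
    [/\ measurable A, (P A <= e%:E)%E & forall t, ~ A t -> E (n, t)]].

Global Instance in_prob_filter : Filter in_prob.
Proof.
split.
- by move=> e e0; near=> n; exists set0; split => //; rewrite measure0 lee_fin ltW.
- move=> E F hE hF e e0; have e20 : 0 < e / 2 by rewrite divr_gt0.
  near=> n.
  have [A [mA PA AE]] : exists A, [/\ measurable A, (P A <= (e / 2)%:E)%E &
    forall t, ~ A t -> E (n, t)] by near: n; exact: hE.
  have [B [mB PB BF]] : exists A, [/\ measurable A, (P A <= (e / 2)%:E)%E &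
    forall t, ~ A t -> F (n, t)] by near: n; exact: hF.
  exists (A `|` B); split.
  + exact: measurableU.
  + apply: le_trans (measureU2 P mA mB) _.
    by rewrite (splitr e) EFinD leeD.
  + by move=> t /not_orP[At Bt]; split; [exact: AE|exact: BF].
- move=> E F EF hE e e0; near=> n.
  have [A [mA PA AE]] : exists A, [/\ measurable A, (P A <= e%:E)%E &
    forall t, ~ A t -> E (n, t)] by near: n; exact: hE.
  by exists A; split => // t /AE; exact: EF.
Unshelve. all: by end_near.
Qed.

Lemma in_prob_near (E : set nat) :
  (\forall n \near \oo, E n) -> in_prob [set z | E z.1].
Proof.
move=> hE e e0; near=> n; exists set0; split => //.
  by rewrite measure0 lee_fin ltW.
by move=> t _ /=; near: n.
Unshelve. all: by end_near.
Qed.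

Lemma cvg_in_prob_det (u : nat -> R) (l : R) :
  u @ \oo --> l -> (fun z : nat * T => u z.1) @ in_prob --> l.
Proof. by move=> ul B /ul; exact: in_prob_near. Qed.

Lemma near_in_prob_cvg (f g : nat -> T -> R) (l : R) :
    (\forall n \near \oo, forall t, f n t = g n t) ->
    (fun z => g z.1 z.2) @ in_prob --> l -> (fun z => f z.1 z.2) @ in_prob --> l.
Proof.
move=> fg gl; apply: cvg_trans gl; apply: near_eq_cvg.
apply: (@filterS _ in_prob _ _ _ _ (in_prob_near fg)) => z /= h.
by rewrite h.
Qed.

Lemma markov_sqr (f : T -> R) (e : R) : allmom P f -> 0 < e ->
  (P [set t | (e <= `|f t|)%R] <= (Ex P (fun t => f t ^+ 2) / e ^+ 2)%:E)%E.
Proof.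
move=> af e0; have [mf _] := af.
pose f' : {mfun T >-> R} := HB.pack f (isMeasurableFun.Build _ _ _ _ f mf).
have af2 : allmom P (fun t => f t ^+ 2) by exact: allmomM.
have := @markov _ _ _ P f' (fun x => x ^+ 2) e e0.
rewrite unlock => h.
have {}h : ((e ^+ 2)%:E * P [set t | (e <= `|f t|)%R] <=
    (Ex P (fun t => f t ^+ 2))%:E)%E.
  rewrite /Ex /Rintegral fineK; last first.
    by apply: integrable_fin_num => //; exact: allmom_integrable.
  under eq_integral do rewrite -real_normK ?num_real//.
  apply: h.
  - exact: exprn_measurable.
  - by move=> r _; exact: sqr_ge0.
  - by move=> x y; rewrite !nnegrE => x0 y0 xy; rewrite lerXn2r.
rewrite EFinM lee_pdivlMr ?exprn_gt0//.
by rewrite muleC.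
Qed.

Lemma cvg_in_prob0 (f : nat -> T -> R) (b : nat -> R) :
    (forall n, allmom P (f n)) ->
    (\forall n \near \oo, Ex P (fun t => f n t ^+ 2) <= b n) ->
    b @ \oo --> (0 : R) ->
  (fun z => f z.1 z.2) @ in_prob --> (0 : R).
Proof.
move=> af fb b0; apply/cvgr0Pnorm_lt => e e0 s s0; near=> n.
exists [set t | e <= `|f n t|]; split.
- have [mf _] := af n.
  rewrite -[X in measurable X]setTI.
  have mnf : measurable_fun setT (fun t => `|f n t|) by exact: measurableT_comp.
  have := mnf measurableT `[e, +oo[%classic (measurable_itv _).
  by congr measurable; apply/seteqP; split => t [_ /=]; rewrite in_itv/= andbT.
- apply: le_trans (markov_sqr (af n) e0) _.
  rewrite lee_fin ler_pdivrMr ?exprn_gt0//.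
  have h1 : Ex P (fun t => f n t ^+ 2) <= b n by near: n.
  apply: le_trans h1 _; apply: le_trans (ler_norm _) _.
  near: n; move/cvgr0Pnorm_le : b0; apply.
  by rewrite mulr_gt0// exprn_gt0.
- by move=> t /negP /=; rewrite -ltNge.
Unshelve. all: by end_near.
Qed.

Lemma allmom_bounded (f : T -> R) (M : R) : measurable_fun setT f ->
  (forall t, `|f t| <= M) -> allmom P f.
Proof.
move=> mf fM; split=> // n.
apply: (@le_integrable _ _ _ _ _ measurableT _ (cst (M ^+ n)%:E)).
- by apply/measurable_EFinP/measurable_funX; exact: measurableT_comp.
- move=> t _; rewrite !abse_EFin lee_fin.
  apply: le_trans (ler_norm _); rewrite ger0_norm ?exprn_ge0//.
  by rewrite lerXn2r ?nnegrE// (le_trans _ (fM t)).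
- exact: finite_measure_integrable_cst.
Qed.

Lemma expectationEx (f : T -> R) : allmom P f -> expectation P f = (Ex P f)%:E.
Proof.
move=> af; rewrite unlock /Ex /Rintegral fineK//.
by apply: integrable_fin_num => //; exact: allmom_integrable.
Qed.

Lemma cvg_expectation_in_prob (f : nat -> T -> R) (M l : R) :
    (forall n, measurable_fun setT (f n)) -> (forall n t, `|f n t| <= M) ->
    (fun z => f z.1 z.2) @ in_prob --> l ->
  (fun n => expectation P (f n)) @ \oo --> l%:E.
Proof.
move=> mf fM fl.
have af n : allmom P (f n) by exact: allmom_bounded (mf n) (fM n).
under eq_fun do rewrite (expectationEx (af _)).
apply: cvg_EFin; first exact: nearW.
apply/cvgrPdist_le => e e0.
have M0 : 0 <= M by apply: le_trans (fM 0%N point).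
pose K := M + `|l| + 1; have K0 : 0 < K by rewrite /K; have := normr_ge0 l; lra.
have e20 : 0 < e / 2 by rewrite divr_gt0.
have eK0 : 0 < e / 2 / K by rewrite divr_gt0.
have /cvgrPdist_le/(_ _ e20)/(_ _ eK0) bad := fl.
near=> n.
have [A [mA PA hA]] : exists A, [/\ measurable A, (P A <= (e / 2 / K)%:E)%E &
    forall t, ~ A t -> `|l - f n t| <= e / 2] by near: n; exact: bad.
have aA : allmom P (\1_A : T -> R).
  apply: (@allmom_bounded _ 1); first exact: measurable_indic.
  by move=> t; rewrite indicE; case: (_ \in _); rewrite ?normr1 ?normr0.
have al : allmom P (fun t => l - f n t).
  apply: (@allmom_bounded _ K); first exact: measurable_funB.
  move=> t; apply: le_trans (ler_normB _ _) _; rewrite /K.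
  have := fM n t; lra.
have aal : allmom P (fun t => `|l - f n t|).
  apply: (@allmom_bounded _ K).
    by apply: measurableT_comp => //; exact: measurable_funB.
  move=> t; rewrite normr_id; apply: le_trans (ler_normB _ _) _; rewrite /K.
  have := fM n t; lra.
have EA : Ex P (\1_A : T -> R) = fine (P A).
  by rewrite /Ex /Rintegral integral_indic// setIT.
have -> : l - Ex P (f n) = Ex P (fun t => l - f n t).
  rewrite (@eq_Ex _ _ _ P (fun t => l - f n t) (fun t => cst l t + -1 * f n t)).
    2: by move=> t /=; rewrite mulN1r.
  have a1 : allmom P (fun t => -1 * f n t).
    by apply: allmomM => //; exact: allmom_cst.
  by rewrite ExD// ?ExZ// ?Ex_cst ?mulN1r//; exact: allmom_cst.
apply: le_trans (le_normr_Rintegral measurableT (allmom_integrable al)) _.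
apply: (@le_trans _ _ (Ex P (fun t => cst (e / 2) t + K * \1_A t))).
  apply: Ex_le => //.
    by apply: allmomD; [exact: allmom_cst|apply: allmomM => //; exact: allmom_cst].
  move=> t /=; have [At|At] := pselect (A t).
    rewrite indicE mem_set// mulr1; apply: le_trans (ler_normB _ _) _.
    rewrite /K; have := fM n t; lra.
  by rewrite indicE memNset// mulr0 addr0; exact: hA.
have aK : allmom P (fun t => K * \1_A t).
  by apply: allmomM => //; exact: allmom_cst.
rewrite ExD//; last exact: allmom_cst.
rewrite Ex_cst ExZ// EA [leRHS](splitr e) lerD2l mulrC -ler_pdivlMr//.
by rewrite -lee_fin fineK ?fin_num_measure.
Unshelve. all: by end_near.
Qed.

End InProbability.

Section NormalCdf.
Context {R : realType}.

Lemma Phi_ge0 (x : R) : 0 <= Phi x.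
Proof. exact: fine_ge0. Qed.

Lemma Phi_le1 (x : R) : Phi x <= 1.
Proof.
rewrite -lee_fin fineK; first exact: probability_le1.
exact: fin_num_measure.
Qed.

Lemma Phi_increment (x y : R) : x <= y -> 0 <= Phi y - Phi x <= normal_peak 1 * (y - x).
Proof.
move=> xy; have p0 := normal_peak_ge0 (1 : R).
have E : normal_prob 0 1 `]-oo, y] =
    (normal_prob 0 1 `]-oo, x] + normal_prob 0 1 `]x, y])%E :> \bar R.
  rewrite -measureU//.
    congr (normal_prob 0 1 _); apply/seteqP; split => z /=; rewrite !in_itv/=.
      by move=> zy; case: (leP z x) => xz; [left|right; apply/andP].
    by move=> [zx|/andP[]//]; exact: le_trans zx xy.
  apply/seteqP; split => // z /=; rewrite !in_itv/= => -[zx /andP[xz _]].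
  by have := lt_le_trans xz zx; rewrite ltxx.
have -> : Phi y - Phi x = fine (normal_prob 0 1 `]x, y]).
  by rewrite /Phi E fineD ?fin_num_measure// addrC addKr.
rewrite fine_ge0//= -lee_fin fineK ?fin_num_measure//.
rewrite /normal_prob.
apply: (@le_trans _ _ (\int[lebesgue_measure]_(z in `]x, y]) (normal_peak 1)%:E)%E).
  apply: ge0_le_integral => //.
  - by move=> z _; rewrite lee_fin normal_pdf_ge0.
  - by apply/measurable_EFinP/measurable_funTS; exact: measurable_normal_pdf.
  - by move=> z _; rewrite lee_fin normal_pdf_ub// oner_neq0.
rewrite integral_cst//= lebesgue_measure_itv/=.
case: ifPn => _; first by rewrite -EFinD -EFinM.
by rewrite mule0 lee_fin mulr_ge0// subr_ge0.
Qed.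

Lemma continuous_Phi : continuous (@Phi R).
Proof.
move=> x; apply/cvgrPdist_le => e e0.
have k0 : 0 < normal_peak 1 :> R by rewrite normal_peak_gt0 ?oner_neq0.
exists (e / normal_peak 1); first by rewrite /= divr_gt0.
move=> y /= xy; have {}xy : normal_peak 1 * `|x - y| <= e.
  by rewrite mulrC -ler_pdivlMr// ltW.
have [h|h] := leP x y.
  have /andP[h1 h2] := Phi_increment h.
  by rewrite distrC ger0_norm// (le_trans h2)// -[y - x]ger0_norm ?subr_ge0// distrC.
have /andP[h1 h2] := Phi_increment (ltW h).
by rewrite ger0_norm// (le_trans h2)// -[x - y]ger0_norm// subr_ge0 ltW.
Qed.

Lemma measurable_Phi : measurable_fun setT (@Phi R).
Proof. by apply: continuous_measurable_fun; exact: continuous_Phi. Qed.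

End NormalCdf.

Section RandomVectorsMeasurability.
Context {d : measure_display} {T : measurableType d} {R : realType}.

Lemma measurable_inv_sqrt (f : T -> R) : measurable_fun setT f ->
  measurable_fun setT (fun t => (Num.sqrt (f t))^-1).
Proof.
move=> mf; under eq_fun do rewrite -powR_inv1 ?sqrtr_ge0//.
apply: (measurableT_comp (f := fun x : R => x `^ (-1))).
  exact: measurable_powR.
apply: measurableT_comp mf; apply: continuous_measurable_fun.
exact: sqrt_continuous.
Qed.

Lemma measurable_sum (K : finType) (f : K -> T -> R) :
  (forall k, measurable_fun setT (f k)) -> measurable_fun setT (fun t => \sum_k f k t).
Proof.
move=> mf; elim: (index_enum K) => [|k s IH].
  by under eq_fun do rewrite big_nil; exact: measurable_cst.
by under eq_fun do rewrite big_cons; exact: measurable_funD.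
Qed.

Variable p : nat.
Implicit Types U V : T -> 'cV[R]_p.

Lemma rvec_cst (u : 'cV[R]_p) : rvec (fun _ : T => u).
Proof. by move=> l; exact: measurable_cst. Qed.

Lemma rvecD U V : rvec U -> rvec V -> rvec (fun t => U t + V t).
Proof.
by move=> mU mV l; under eq_fun do rewrite mxE; apply: measurable_funD.
Qed.

Lemma rvecZ a U : rvec U -> rvec (fun t => a *: U t).
Proof.
by move=> mU l; under eq_fun do rewrite mxE; apply: measurable_funM.
Qed.

Lemma rvecB U V : rvec U -> rvec V -> rvec (fun t => U t - V t).
Proof.
move=> mU mV; under eq_fun do rewrite -scaleN1r.
by apply: rvecD => //; exact: rvecZ.
Qed.

Lemma rvec_smean n (X : 'I_n -> T -> 'cV[R]_p) :
  (forall k, rvec (X k)) -> rvec (fun t => smean (fun k => X k t)).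
Proof.
move=> mX; apply: rvecZ => l; under eq_fun do rewrite summxE.
by apply: measurable_sum => k; exact: mX.
Qed.

Lemma measurable_qf (S : 'M[R]_p) U V : rvec U -> rvec V ->
  measurable_fun setT (fun t => qf S (U t) (V t)).
Proof.
move=> mU mV; rewrite /qf; under eq_fun do rewrite mxE.
apply: measurable_sum => j; apply: measurable_funM; last exact: mV.
under eq_fun do rewrite mxE.
apply: measurable_sum => i; apply: measurable_funM => //.
by under eq_fun do rewrite mxE; exact: mU.
Qed.

Lemma measurable_lda_err (S : 'M[R]_p) c mui U V i : rvec U -> rvec V ->
  measurable_fun setT (fun t => lda_err S c mui (U t) (V t) i).
Proof.
move=> mU mV; rewrite /lda_err/=; apply: (measurableT_comp measurable_Phi).
apply: measurable_funM; last first.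
  by apply: measurable_inv_sqrt; apply: measurable_qf; exact: rvecB.
apply: measurable_funD => //; apply: measurable_funM => //.
apply: measurable_qf; last exact: rvecB.
by apply: rvecB; [exact: rvec_cst|apply: rvecZ; exact: rvecD].
Qed.

Lemma measurable_bayes_err (S : 'M[R]_p) c n nu mi W U V i :
    rvec W -> rvec U -> rvec V ->
  measurable_fun setT (fun t => bayes_err S c n nu mi (W t) (U t) (V t) i).
Proof.
move=> mW mU mV; rewrite /bayes_err/=; apply: (measurableT_comp measurable_Phi).
apply: measurable_funM => //; apply: measurable_funM => //.
apply: measurable_funM; last first.
  by apply: measurable_inv_sqrt; apply: measurable_qf; exact: rvecB.
apply: measurable_funD => //; apply: measurableT_comp => //.
apply: measurable_qf; last exact: rvecB.
apply: rvecB; last by apply: rvecZ; exact: rvecD.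
by apply: rvecZ; apply: rvecD; [exact: rvecZ|exact: rvec_cst].
Qed.

End RandomVectorsMeasurability.

(** * Limits of the quadratic forms and of the errors *)

Section Noise.
Context {d : measure_display} {T : measurableType d} {R : realType}.
Variable P : probability T R.
Variables (I : finType) (p : nat) (X : I -> T -> 'cV[R]_p) (mu : I -> 'cV[R]_p).
Variable S : 'M[R]_p.
Hypothesis gX : forall k, gaussian_vec P (X k) (mu k) S.
Hypothesis indepX : indep_vecs P X.
Hypothesis spdS : spd S.

Definition noise (w : I -> R) (t : T) : 'cV[R]_p :=
  \sum_k w k *: (X k t - mu k).

Let mulmx_noise (A : 'M[R]_p) w t a :
  (A *m noise w t) a 0 = \sum_k w k * whitened X mu A k a t.
Proof.
rewrite /noise mulmx_sumr summxE; apply: eq_bigr => k _.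
by rewrite -scalemxAr mxE.
Qed.

Let mX k : rvec (X k). Proof. by case: (gX k). Qed.

Let qf_noise (A : 'M[R]_p) u w t : A *m S *m A^T = 1%:M ->
  qf S u (noise w t) = \sum_k w k * \sum_a (A *m u) a 0 * whitened X mu A k a t.
Proof.
move=> hA; rewrite (qf_whitening _ _ hA) /vdot.
under eq_bigr do rewrite mulmx_noise mulr_sumr.
rewrite exchange_big/=; apply: eq_bigr => k _; rewrite mulr_sumr.
by apply: eq_bigr => a _; rewrite mulrCA.
Qed.

Let qf_noise2 (A : 'M[R]_p) w w' t : A *m S *m A^T = 1%:M ->
  qf S (noise w t) (noise w' t) - p%:R * (\sum_k w k * w' k) =
  \sum_z (w z.1 * w' z.2) * gram (whitened X mu A) z.1 z.2 t.
Proof.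
move=> hA; rewrite (qf_whitening _ _ hA) /vdot.
rewrite -(pair_bigA _ (fun k l => (w k * w' l) * gram (whitened X mu A) k l t))/=.
under [RHS]eq_bigr do under eq_bigr do rewrite /gram mulrBr.
under [RHS]eq_bigr do rewrite sumrB.
rewrite sumrB; congr (_ - _).
  under eq_bigr do rewrite !mulmx_noise mulr_suml.
  rewrite exchange_big/=; apply: eq_bigr => k _.
  under eq_bigr do rewrite mulr_sumr.
  rewrite exchange_big/=; apply: eq_bigr => l _; rewrite mulr_sumr.
  by apply: eq_bigr => a _; rewrite mulrACA.
rewrite mulr_sumr; apply: eq_bigr => k _.
rewrite (bigD1 k)//= eqxx mulr1 big1 ?addr0 => [|l /negbTE lk]; first by rewrite mulrC.
by rewrite eq_sym lk !mulr0.
Qed.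

Lemma allmom_qf_noise u w : allmom P (fun t => qf S u (noise w t)).
Proof.
have [A hA] := spd_whitening spdS.
under eq_fun do rewrite (qf_noise _ _ _ hA).
apply: allmom_sum => k; apply: allmomM; first exact: allmom_cst.
apply: allmom_sum => a; apply: allmomM; first exact: allmom_cst.
exact: (allmom_whitened gX hA).
Qed.

Lemma Ex_qf_noise_sqr u w :
  Ex P (fun t => qf S u (noise w t) ^+ 2) = (\sum_k w k ^+ 2) * qf S u u.
Proof.
have [A hA] := spd_whitening spdS.
under eq_fun do rewrite (qf_noise _ _ _ hA).
rewrite (linear_sum_sqr mX indepX).
- by rewrite (qf_whitening _ _ hA); congr (_ * _); apply: eq_bigr => a _; rewrite expr2.
- by move=> J k a; exact: dep_whitened.
- exact: (allmom_whitened gX hA).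
- exact: (Ex_whitened gX hA).
- exact: (Ex_whitened_mul gX hA).
Qed.

Lemma allmom_qf_noise2 w w' c :
  allmom P (fun t => qf S (noise w t) (noise w' t) - c).
Proof.
have [A hA] := spd_whitening spdS.
have -> : (fun t => qf S (noise w t) (noise w' t) - c) =
    (fun t => (\sum_z (w z.1 * w' z.2) * gram (whitened X mu A) z.1 z.2 t) +
      (p%:R * (\sum_k w k * w' k) - c)).
  by apply/funext => t; rewrite -qf_noise2// addrA subrK.
apply: allmomD; last exact: allmom_cst.
apply: allmom_sum => z; apply: allmomM; first exact: allmom_cst.
by apply: allmom_gram; exact: (allmom_whitened gX hA).
Qed.

Lemma Ex_qf_noise2_sqr (C : R) w w' :
    (forall m, (\int[normal_prob m 1]_x ((x - m) ^+ 4)%:E <= C%:E)%E) ->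
  Ex P (fun t => (qf S (noise w t) (noise w' t) - p%:R * (\sum_k w k * w' k)) ^+ 2) <=
  2 * (p%:R * ((\sum_k w k ^+ 2) * (\sum_k w' k ^+ 2)) +
       (C + 1) * p%:R ^+ 2 * \sum_k w k ^+ 2 * w' k ^+ 2).
Proof.
move=> hC; have [A hA] := spd_whitening spdS.
under eq_fun do rewrite (qf_noise2 _ _ _ hA).
have := @gram_sum_bound _ _ _ P I p X mX indepX (whitened X mu A) _ _ _ _ (C + 1) _
  (fun z => w z.1 * w' z.2).
move=> /(_ (fun J k a => dep_whitened mu A a)).
move=> /(_ (allmom_whitened gX hA) (Ex_whitened gX hA) (Ex_whitened_mul gX hA)).
move=> /(_ (fun k a => Ex_whitened_pow4 gX hA k a hC)) h.
apply: le_trans h _; rewrite ler_pM2l//.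
rewrite -(pair_bigA _ (fun k l => (w k * w' l) ^+ 2 * gram_bound p (C + 1) k l))/=.
rewrite mulr_suml [X in _ <= X + _]mulr_sumr [X in _ <= _ + X]mulr_sumr -big_split/=.
apply: ler_sum => k _; rewrite !mulr_sumr.
rewrite (bigD1 k)//= [X in _ <= X + _](bigD1 k)//=.
rewrite /gram_bound eqxx addrAC; apply: lerD.
  by rewrite !exprMn mulrC lerDr mulr_ge0// mulr_ge0// sqr_ge0.
apply: ler_sum => l /negbTE lk; rewrite eq_sym lk exprMn mulrC.
exact: lexx.
Qed.

End Noise.

Section TwoSample.
Context {d : measure_display} {T : measurableType d} {R : realType}.
Variable P : probability T R.
Variable Sigma : forall p : nat, 'M[R]_p.
Hypothesis spdSigma : forall p, spd (Sigma p).
Variables (mu0 mu1 : forall p : nat, 'cV[R]_p) (n0 n1 : nat -> nat).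
Variable X : forall p : nat, 'I_(n0 p) + 'I_(n1 p) -> T -> 'cV[R]_p.
Hypothesis indepX : forall p, indep_vecs P (@X p).
Hypothesis gauss0 : forall p k, gaussian_vec P (@X p (inl k)) (mu0 p) (Sigma p).
Hypothesis gauss1 : forall p k, gaussian_vec P (@X p (inr k)) (mu1 p) (Sigma p).
Variables J0 J1 : R.
Hypothesis n0_oo : (fun p => (n0 p)%:R : R) @ \oo --> +oo.
Hypothesis n1_oo : (fun p => (n1 p)%:R : R) @ \oo --> +oo.
Hypothesis J0_lim : (fun p => p%:R / (n0 p)%:R : R) @ \oo --> J0.
Hypothesis J1_lim : (fun p => p%:R / (n1 p)%:R : R) @ \oo --> J1.

Let mu (b : bool) := if b then mu1 else mu0.
Let n (b : bool) := if b then n1 else n0.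
Let J (b : bool) := if b then J1 else J0.

Definition class_mean (b : bool) p t : 'cV[R]_p :=
  if b then smean (fun k => @X p (inr k) t) else smean (fun k => @X p (inl k) t).

Let cmean p (k : 'I_(n0 p) + 'I_(n1 p)) := if k is inl _ then mu0 p else mu1 p.

Let wt p (b : bool) (k : 'I_(n0 p) + 'I_(n1 p)) : R := match k with
  | inl _ => if b then 0 else (n0 p)%:R^-1
  | inr _ => if b then (n1 p)%:R^-1 else 0 end.

Let gX p k : gaussian_vec P (@X p k) (@cmean p k) (Sigma p).
Proof. by case: k => k; [exact: gauss0|exact: gauss1]. Qed.

Let zeta b p t := noise (@X p) (@cmean p) (@wt p b) t.

Let class_meanE b p t : (0 < n b p)%N -> class_mean b p t = mu b p + zeta b p t.
Proof.
have smeanE m (x : 'I_m -> 'cV[R]_p) u : (0 < m)%N ->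
    smean x = u + \sum_k m%:R^-1 *: (x k - u).
  move=> m0; rewrite /smean scaler_sumr.
  under [in RHS]eq_bigr do rewrite scalerBr.
  rewrite sumrB sumr_const card_ord scalerMnl -[X in X *: u]mulr_natr.
  by rewrite mulVf ?scale1r ?pnatr_eq0 -?lt0n// addrCA subrr addr0.
rewrite /class_mean /zeta /noise big_sumType/= /n /mu /wt /cmean.
case: b => n_gt0.
  rewrite (smeanE _ _ (mu1 p) n_gt0) [X in _ = _ + (X + _)]big1 ?add0r// => k _.
  by rewrite scale0r.
rewrite (smeanE _ _ (mu0 p) n_gt0) [X in _ = _ + (_ + X)]big1 ?addr0// => k _.
by rewrite scale0r.
Qed.

Let n_oo b : (fun p => (n b p)%:R : R) @ \oo --> +oo.
Proof. by case: b. Qed.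

Let n_gt0 b : \forall p \near \oo, (0 < n b p)%N.
Proof.
have /cvgryPgt /(_ 0) := @n_oo b; apply: filterS => p.
by rewrite ltr0n.
Qed.

Let invn0 b : (fun p => (n b p)%:R^-1 : R) @ \oo --> (0 : R).
Proof.
apply/gtr0_cvgV0; last exact: n_oo.
by near=> p; rewrite ltr0n; near: p; exact: n_gt0.
Unshelve. all: by end_near.
Qed.

Let J_lim b : (fun p => p%:R / (n b p)%:R : R) @ \oo --> J b.
Proof. by case: b. Qed.

Let invn_sum (m : nat) : (m%:R^-1 * m%:R^-1) *+ m = m%:R^-1 :> R.
Proof.
case: m => [|m]; first by rewrite mulr0n invr0.
by rewrite -mulr_natr -mulrA mulVf ?pnatr_eq0// mulr1.
Qed.

Let sum_wtM p b b' : \sum_k @wt p b k * @wt p b' k =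
  (b == b')%:R * (n b p)%:R^-1.
Proof.
rewrite big_sumType/= !sumr_const !card_ord /n; case: b; case: b' => /=;
  by rewrite ?mulr0 ?mul0r ?mul0rn ?addr0 ?add0r ?mul1r ?invn_sum.
Qed.

Let sum_wt2 p b : \sum_k @wt p b k ^+ 2 = (n b p)%:R^-1.
Proof.
by under eq_bigr do rewrite expr2; rewrite sum_wtM eqxx mul1r.
Qed.

Let sum_wt22 p b b' : \sum_k @wt p b k ^+ 2 * @wt p b' k ^+ 2 =
  (b == b')%:R * (n b p)%:R^-1 ^+ 3.
Proof.
have h m : (m%:R^-1 ^+ 2 * m%:R^-1 ^+ 2) *+ m = m%:R^-1 ^+ 3 :> R.
  case: m => [|m]; first by rewrite mulr0n invr0 expr0n.
  by rewrite -exprD [_ ^+ (2 + 2)]exprSr -mulr_natr -mulrA mulVf ?mulr1// pnatr_eq0.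
rewrite big_sumType/= !sumr_const !card_ord /n; case: b; case: b' => /=;
  by rewrite ?expr0n ?mulr0 ?mul0r ?mul0rn ?addr0 ?add0r ?mul1r ?h.
Qed.

Lemma cvg_qf_class_mean (u : forall p, 'cV[R]_p) b (a l : R) :
    (fun p => qf (Sigma p) (u p) (u p)) @ \oo --> a ->
    (fun p => qf (Sigma p) (u p) (mu b p)) @ \oo --> l ->
  (fun z => qf (Sigma z.1) (u z.1) (class_mean b z.1 z.2)) @ in_prob P --> l.
Proof.
move=> ua ul.
apply: (@near_in_prob_cvg _ _ _ P
  (fun p t => qf (Sigma p) (u p) (class_mean b p t))
  (fun p t => qf (Sigma p) (u p) (mu b p) + qf (Sigma p) (u p) (zeta b p t))).
  by apply: filterS (n_gt0 b) => p np t; rewrite class_meanE// qfDr.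
rewrite -[l]addr0; apply: cvgD; first exact: cvg_in_prob_det ul.
apply: (@cvg_in_prob0 _ _ _ P (fun p t => qf (Sigma p) (u p) (zeta b p t))
  (fun p => (n b p)%:R^-1 * qf (Sigma p) (u p) (u p))).
- by move=> p; exact: (allmom_qf_noise (@gX p) (spdSigma p)).
- apply: nearW => p.
  by rewrite (Ex_qf_noise_sqr (@gX p) (@indepX p) (spdSigma p)) sum_wt2.
- by rewrite -[0](mul0r a); apply: cvgM; [exact: invn0|exact: ua].
Qed.

Lemma cvg_qf_class_mean2 b b' (l a a' : R) :
    (fun p => qf (Sigma p) (mu b p) (mu b' p)) @ \oo --> l ->
    (fun p => qf (Sigma p) (mu b p) (mu b p)) @ \oo --> a ->
    (fun p => qf (Sigma p) (mu b' p) (mu b' p)) @ \oo --> a' ->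
  (fun z => qf (Sigma z.1) (class_mean b z.1 z.2) (class_mean b' z.1 z.2))
    @ in_prob P --> l + (b == b')%:R * J b.
Proof.
move=> ml ma ma'.
have [C4 hC] := @normal_even_moment_bound R 2.
pose ez p := p%:R * \sum_k @wt p b k * @wt p b' k : R.
pose N p t := qf (Sigma p) (zeta b p t) (zeta b' p t).
apply: (@near_in_prob_cvg _ _ _ P
  (fun p t => qf (Sigma p) (class_mean b p t) (class_mean b' p t))
  (fun p t => qf (Sigma p) (mu b p) (class_mean b' p t) +
    (qf (Sigma p) (mu b' p) (class_mean b p t) - qf (Sigma p) (mu b p) (mu b' p) +
     ((N p t - ez p) + ez p)))).
  near=> p => t; have nb : (0 < n b p)%N by near: p; exact: n_gt0.
  have nb' : (0 < n b' p)%N by near: p; exact: n_gt0.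
  rewrite !class_meanE// !qfDr !qfDl (qfC (mu b' p) (mu b p))//.
  rewrite (qfC (mu b' p) (zeta b p t))// subrK /N; ring.
have -> : l + (b == b')%:R * J b = l + (l - l + (0 + (b == b')%:R * J b)).
  by rewrite subrr !add0r.
have mC : (fun p => qf (Sigma p) (mu b' p) (mu b p)) @ \oo --> l.
  by under eq_fun do rewrite qfC//.
apply: cvgD; first exact: (cvg_qf_class_mean ma ml).
apply: cvgD.
  by apply: cvgB; [exact: (cvg_qf_class_mean ma' mC)|exact: cvg_in_prob_det ml].
have ezlim : ez @ \oo --> (b == b')%:R * J b.
  rewrite /ez; under eq_fun do rewrite sum_wtM mulrCA.
  by apply: cvgM; [exact: cvg_cst|exact: J_lim].
apply: cvgD; last exact: cvg_in_prob_det ezlim.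
apply: (@cvg_in_prob0 _ _ _ P (fun p t => N p t - ez p)
  (fun p => 2 * ((p%:R / (n b p)%:R) * (n b' p)%:R^-1 +
    (C4 + 1) * ((b == b')%:R * ((p%:R / (n b p)%:R) ^+ 2 * (n b p)%:R^-1))))).
- by move=> p; exact: (allmom_qf_noise2 (@gX p) (spdSigma p)).
- apply: nearW => p; apply: le_trans
    (Ex_qf_noise2_sqr (@gX p) (@indepX p) (spdSigma p) _ _ hC) _.
  rewrite !sum_wt2 sum_wt22 le_eqVlt; apply/orP; left; apply/eqP.
  move: ((n b p)%:R^-1 : R) ((n b' p)%:R^-1 : R) ((b == b')%:R : R) => x y e.
  by ring.
- have -> : 0 = 2 * (J b * 0 + (C4 + 1) * ((b == b')%:R * (J b ^+ 2 * 0))) :> R.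
    by rewrite !mulr0 addr0 mulr0.
  apply: cvgM; first exact: cvg_cst.
  apply: cvgD; first by apply: cvgM; [exact: J_lim|exact: invn0].
  apply: cvgM; first exact: cvg_cst.
  apply: cvgM; first exact: cvg_cst.
  apply: cvgM; last exact: invn0.
  by under eq_fun do rewrite expr2; apply: cvgM; exact: J_lim.
Unshelve. all: by end_near.
Qed.

End TwoSample.

Section ErrorLimits.
Context {d : measure_display} {T : measurableType d} {R : realType}.
Variable F : set_system (nat * T).
Context {FF : Filter F}.
Variable Sigma : forall p : nat, 'M[R]_p.
Variables a b : forall z : nat * T, 'cV[R]_z.1.
Variables aa ab bb : R.
Hypothesis cvg_aa : (fun z => qf (Sigma z.1) (a z) (a z)) @ F --> aa.
Hypothesis cvg_ab : (fun z => qf (Sigma z.1) (a z) (b z)) @ F --> ab.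
Hypothesis cvg_ba : (fun z => qf (Sigma z.1) (b z) (a z)) @ F --> ab.
Hypothesis cvg_bb : (fun z => qf (Sigma z.1) (b z) (b z)) @ F --> bb.
Variable D : R.
Hypothesis DE : D = aa - 2 * ab + bb.
Hypothesis D_gt0 : 0 < D.

Let cvg_dhat_inv :
  (fun z => (Num.sqrt (qf (Sigma z.1) (a z - b z) (a z - b z)))^-1) @ F
    --> (Num.sqrt D)^-1.
Proof.
apply: cvgV; first by rewrite gt_eqF ?sqrtr_gt0.
apply: continuous_cvg; first exact: sqrt_continuous.
under eq_fun do rewrite qfDl !qfDr !qfNl !qfNr.
have -> : D = (aa + - ab) + (- ab + - - bb) by rewrite DE; ring.
by apply: cvgD; apply: cvgD => //; apply: cvgN => //; apply: cvgN.
Qed.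

Lemma cvg_qf_centered (u : forall z : nat * T, 'cV[R]_z.1) (ua ub : R) :
    (fun z => qf (Sigma z.1) (u z) (a z)) @ F --> ua ->
    (fun z => qf (Sigma z.1) (u z) (b z)) @ F --> ub ->
  (fun z => qf (Sigma z.1) (u z - 2%:R^-1 *: (a z + b z)) (a z - b z)) @ F
    --> ua - ub - 2^-1 * (aa - bb).
Proof.
move=> hua hub.
under eq_fun do rewrite qfDl qfNl qfZl qfDl !qfDr !qfNr.
have -> : aa - bb = (aa + - ab) + (ab + - bb) by ring.
apply: cvgB; first exact: cvgB.
apply: cvgM; first exact: cvg_cst.
by apply: cvgD; apply: cvgB.
Qed.

Lemma cvg_lda_err (u : forall z : nat * T, 'cV[R]_z.1) (ua ub c : R) i :
    (fun z => qf (Sigma z.1) (u z) (a z)) @ F --> ua ->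
    (fun z => qf (Sigma z.1) (u z) (b z)) @ F --> ub ->
  (fun z => lda_err (Sigma z.1) c (u z) (a z) (b z) i) @ F -->
    Phi (((-1) ^+ i.+1 * (ua - ub - 2^-1 * (aa - bb)) + (-1) ^+ i * c) / Num.sqrt D).
Proof.
move=> hua hub; rewrite /lda_err/=.
apply: continuous_cvg; first exact: continuous_Phi.
apply: cvgM; last exact: cvg_dhat_inv.
apply: cvgD; last exact: cvg_cst.
apply: cvgM; first exact: cvg_cst.
exact: cvg_qf_centered.
Qed.

Lemma cvg_bayes_err (n : nat -> nat) (nu : nat -> R) (x : forall z : nat * T, 'cV[R]_z.1)
    (m : forall p : nat, 'cV[R]_p) (xa xb ma mb r s c : R) i :
    (fun z => qf (Sigma z.1) (x z) (a z)) @ F --> xa ->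
    (fun z => qf (Sigma z.1) (x z) (b z)) @ F --> xb ->
    (fun z => qf (Sigma z.1) (m z.1) (a z)) @ F --> ma ->
    (fun z => qf (Sigma z.1) (m z.1) (b z)) @ F --> mb ->
    (fun z : nat * T => ((n z.1)%:R + nu z.1)^-1 * (n z.1)%:R) @ F --> r ->
    (fun z : nat * T => ((n z.1)%:R + nu z.1)^-1 * nu z.1) @ F --> s ->
    (fun z : nat * T => Num.sqrt (((n z.1)%:R + nu z.1) / ((n z.1)%:R + nu z.1 + 1)))
      @ F --> (1 : R) ->
  (fun z => bayes_err (Sigma z.1) c (n z.1) (nu z.1) (m z.1) (x z) (a z) (b z) i) @ F -->
    Phi ((-1) ^+ i * ((- (r * xa + s * ma - (r * xb + s * mb) - 2^-1 * (aa - bb)) + c)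
      / Num.sqrt D)).
Proof.
move=> hxa hxb hma hmb hr hs h1; rewrite /bayes_err/=.
apply: continuous_cvg; first exact: continuous_Phi.
rewrite -[X in _ --> X]mulr1; apply: cvgM; last exact: h1.
apply: cvgM; first exact: cvg_cst.
apply: cvgM; last exact: cvg_dhat_inv.
apply: cvgD; last exact: cvg_cst.
apply: cvgN; apply: cvg_qf_centered.
  under eq_fun do rewrite qfZl qfDl !qfZl mulrDr !mulrA.
  by apply: cvgD; apply: cvgM.
under eq_fun do rewrite qfZl qfDl !qfZl mulrDr !mulrA.
by apply: cvgD; apply: cvgM.
Qed.

End ErrorLimits.

Lemma cvg_prior_weights (R : realType) (n : nat -> nat) (nu : nat -> R) (g : R) :
    0 <= g -> (forall p, 0 < nu p) ->
    (fun p => (n p)%:R : R) @ \oo --> +oo ->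
    (fun p => nu p / (n p)%:R) @ \oo --> g ->
  [/\ (fun p => ((n p)%:R + nu p)^-1 * (n p)%:R) @ \oo --> (1 + g)^-1,
      (fun p => ((n p)%:R + nu p)^-1 * nu p) @ \oo --> g / (1 + g) &
      (fun p => Num.sqrt (((n p)%:R + nu p) / ((n p)%:R + nu p + 1))) @ \oo --> (1 : R)].
Proof.
move=> g0 nu0 noo hg.
have n_gt0 : \forall p \near \oo, 0 < (n p)%:R :> R by move/cvgryPgt : noo; exact.
have inv1 : (fun p => (1 + nu p / (n p)%:R)^-1) @ \oo --> (1 + g)^-1.
  apply: cvgV; first by rewrite gt_eqF// ltr_pwDl.
  by apply: cvgD => //; exact: cvg_cst.
split.
- apply: cvg_trans inv1; apply: near_eq_cvg; near=> p.
  have np : 0 < (n p)%:R :> R by near: p.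
  have nup := nu0 p.
  by field; rewrite !gt_eqF ?addr_gt0.
- apply: cvg_trans (cvgM hg inv1); apply: near_eq_cvg; near=> p.
  have np : 0 < (n p)%:R :> R by near: p.
  have nup := nu0 p.
  by rewrite /=; field; rewrite !gt_eqF ?addr_gt0.
- rewrite -[X in _ --> X]sqrtr1; apply: continuous_cvg; first exact: sqrt_continuous.
  have inv0 : (fun p => ((n p)%:R + nu p + 1)^-1) @ \oo --> (0 : R).
    apply/gtr0_cvgV0.
      by apply: nearW => p; rewrite ltr_wpDl// addr_ge0// ltW.
    apply: ger_cvgy noo; apply: nearW => p.
    by rewrite -addrA lerDl addr_ge0// ltW.
  rewrite -[X in _ --> X]subr0.
  have -> : (fun p => ((n p)%:R + nu p) / ((n p)%:R + nu p + 1)) =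
      (fun p => 1 - ((n p)%:R + nu p + 1)^-1).
    apply/funext => p; have nup := nu0 p.
    by field; rewrite gt_eqF// ltr_wpDl// addr_ge0// ltW.
  by apply: cvgB => //; exact: cvg_cst.
Unshelve. all: by end_near.
Qed.

Lemma etaqE (R : realType) p (S : 'M[R]_p) u v : spd S ->
  etaq S u v = qf S u u - 2 * qf S u v + qf S v v.
Proof.
move=> spdS; rewrite /etaq qfDl !qfDr !qfNl !qfNr (qfC v u spdS); ring.
Qed.

Lemma limn_etaq (R : realType) (S : forall p, 'M[R]_p) (u v : forall p, 'cV[R]_p)
    (uu uv vv : R) : (forall p, spd (S p)) ->
    (fun p => qf (S p) (u p) (u p)) @ \oo --> uu ->
    (fun p => qf (S p) (u p) (v p)) @ \oo --> uv ->
    (fun p => qf (S p) (v p) (v p)) @ \oo --> vv ->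
  limn (fun p => etaq (S p) (u p) (v p)) = uu - 2 * uv + vv.
Proof.
move=> spdS huu huv hvv; apply: cvg_lim => //.
under eq_fun do rewrite (etaqE _ _ (spdS _)).
by apply: cvgD => //; apply: cvgB => //; apply: cvgM => //; exact: cvg_cst.
Qed.

Unset Implicit Arguments.

Theorem theorem4 (R : realType) (d : measure_display) (T : measurableType d)
  (P : probability T R)
  (alpha0 : R) (Halpha0 : 0 < alpha0 < 1)
  (Sigma : forall p : nat, 'M[R]_p) (HSigma : forall p, spd (Sigma p))
  (mu0 mu1 m0 m1 : forall p : nat, 'cV[R]_p)
  (n0 n1 : nat -> nat) (nu0 nu1 : nat -> R)
  (Hnu : forall p, 0 < nu0 p /\ 0 < nu1 p)
  (* the sample S_n: points inl k (k < n0) from class 0, inr k (k < n1) from class 1 *)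
  (X : forall p : nat, 'I_(n0 p) + 'I_(n1 p) -> T -> 'cV[R]_p)
  (Hindep : forall p, indep_vecs P (X p))
  (Hgauss0 : forall p (k : 'I_(n0 p)), gaussian_vec P (X p (inl k)) (mu0 p) (Sigma p))
  (Hgauss1 : forall p (k : 'I_(n1 p)), gaussian_vec P (X p (inr k)) (mu1 p) (Sigma p))
  (J0 J1 gam0 gam1 : R)
  (HJ0 : 0 <= J0) (HJ1 : 0 <= J1) (Hgam0 : 0 <= gam0) (Hgam1 : 0 <= gam1)
  (Hn0 : (fun p => (n0 p)%:R : R) @ \oo --> +oo)
  (Hn1 : (fun p => (n1 p)%:R : R) @ \oo --> +oo)
  (Hnu0 : nu0 @ \oo --> +oo)
  (Hnu1 : nu1 @ \oo --> +oo)
  (HJ0lim : (fun p => p%:R / (n0 p)%:R : R) @ \oo --> J0)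
  (HJ1lim : (fun p => p%:R / (n1 p)%:R : R) @ \oo --> J1)
  (Hgam0lim : (fun p => nu0 p / (n0 p)%:R) @ \oo --> gam0)
  (Hgam1lim : (fun p => nu1 p / (n1 p)%:R) @ \oo --> gam1)
  (Hmmu : forall i j : bool, cvgn (fun p =>
      qf (Sigma p) (if i then m1 p else m0 p) (if j then mu1 p else mu0 p)))
  (Hmm : forall i j : bool, cvgn (fun p =>
      qf (Sigma p) (if i then m1 p else m0 p) (if j then m1 p else m0 p)))
  (Hmumu : forall i j : bool, cvgn (fun p =>
      qf (Sigma p) (if i then mu1 p else mu0 p) (if j then mu1 p else mu0 p)))
  (HD : 0 < limn (fun p => etaq (Sigma p) (mu0 p) (mu1 p)) + J0 + J1) :
  let alpha1 := 1 - alpha0 in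
  let c := cthr alpha0 in
  let alpha (i : nat) := if i == 0%N then alpha0 else alpha1 in
  let delta2 := limn (fun p => etaq (Sigma p) (mu0 p) (mu1 p)) in
  let D := delta2 + J0 + J1 in
  let etabar (a b : forall p : nat, 'cV[R]_p) := limn (fun p => etaq (Sigma p) (a p) (b p)) in
  let GB (i : nat) :=
    if i == 0%N then
      (2 * (1 + gam0))^-1 * (gam0 * (etabar m0 mu1 - etabar m0 mu0) + delta2
                              + (1 - gam0) * J0 + (1 + gam0) * J1)
    else
      - (2 * (1 + gam1))^-1 * (gam1 * (etabar m1 mu0 - etabar m1 mu1) + delta2
                              + (1 - gam1) * J1 + (1 + gam1) * J0) in
  let G (i : nat) :=
    if i == 0%N then 2^-1 * (delta2 + J1 - J0) else - (2^-1 * (delta2 + J0 - J1)) in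
  let xb0 p t := smean (fun k => X p (inl k) t) in
  let xb1 p t := smean (fun k => X p (inr k) t) in
  (* true class-j error eps_j *)
  let eps p (j : nat) t :=
    lda_err (Sigma p) c (if j == 0%N then mu0 p else mu1 p) (xb0 p t) (xb1 p t) j in
  (* Bayesian MMSE class-i error estimator hat eps_i^B *)
  let epsB p (i : nat) t :=
    if i == 0%N then bayes_err (Sigma p) c (n0 p) (nu0 p) (m0 p) (xb0 p t) (xb0 p t) (xb1 p t) 0
    else bayes_err (Sigma p) c (n1 p) (nu1 p) (m1 p) (xb1 p t) (xb0 p t) (xb1 p t) 1 in
  let lim_ij (i j : nat) :=
    Phi ((-1) ^+ i * ((- GB i + c) / Num.sqrt D)) *
    Phi ((-1) ^+ j * ((- G j + c) / Num.sqrt D)) in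
  (forall i j : 'I_2,
     (fun p => expectation P (fun t => epsB p i t * eps p j t)) @ \oo --> (lim_ij i j)%:E)
  /\
  ((fun p => expectation P (fun t => (alpha0 * epsB p 0%N t + alpha1 * epsB p 1%N t)
                         * (alpha0 * eps p 0%N t + alpha1 * eps p 1%N t)))
     @ \oo --> (\sum_(i < 2) \sum_(j < 2) alpha i * alpha j * lim_ij i j)%:E).
Proof.
move=> alpha1 c alpha delta2 D etabar GB G xb0 xb1 eps epsB lim_ij.
have mX p k : rvec (X p k).
  by case: k => k; [have [] := Hgauss0 p k|have [] := Hgauss1 p k].
pose q i j := limn (fun p =>
  qf (Sigma p) (if i then mu1 p else mu0 p) (if j then mu1 p else mu0 p)).
pose r i j := limn (fun p =>
  qf (Sigma p) (if i then m1 p else m0 p) (if j then mu1 p else mu0 p)).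
pose s i := limn (fun p =>
  qf (Sigma p) (if i then m1 p else m0 p) (if i then m1 p else m0 p)).
have hq i j : (fun p => qf (Sigma p) (if i then mu1 p else mu0 p)
    (if j then mu1 p else mu0 p)) @ \oo --> q i j by exact: Hmumu.
have hr i j : (fun p => qf (Sigma p) (if i then m1 p else m0 p)
    (if j then mu1 p else mu0 p)) @ \oo --> r i j by exact: Hmmu.
have hs i : (fun p => qf (Sigma p) (if i then m1 p else m0 p)
    (if i then m1 p else m0 p)) @ \oo --> s i by exact: Hmm.
have q10 : q true false = q false true.
  by congr (limn _); apply/funext => p; exact: qfC.
have delta2E : delta2 = q false false - 2 * q false true + q true true.
  exact: (limn_etaq HSigma (hq false false) (hq false true) (hq true true)).
have eta01 : etabar m0 mu1 = s false - 2 * r false true + q true true.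
  exact: (limn_etaq HSigma (hs false) (hr false true) (hq true true)).
have eta00 : etabar m0 mu0 = s false - 2 * r false false + q false false.
  exact: (limn_etaq HSigma (hs false) (hr false false) (hq false false)).
have eta10 : etabar m1 mu0 = s true - 2 * r true false + q false false.
  exact: (limn_etaq HSigma (hs true) (hr true false) (hq false false)).
have eta11 : etabar m1 mu1 = s true - 2 * r true true + q true true.
  exact: (limn_etaq HSigma (hs true) (hr true true) (hq true true)).
pose cmean := @cvg_qf_class_mean _ _ _ P Sigma HSigma mu0 mu1 n0 n1 X Hindep
  Hgauss0 Hgauss1 Hn0 Hn1.
pose cmean2 := @cvg_qf_class_mean2 _ _ _ P Sigma HSigma mu0 mu1 n0 n1 X Hindep
  Hgauss0 Hgauss1 J0 J1 Hn0 Hn1 HJ0lim HJ1lim.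
have aa : (fun z => qf (Sigma z.1) (xb0 z.1 z.2) (xb0 z.1 z.2)) @ in_prob P
    --> q false false + J0.
  rewrite -[J0]mul1r.
  exact: (cmean2 false false _ _ _ (hq false false) (hq false false) (hq false false)).
have bb : (fun z => qf (Sigma z.1) (xb1 z.1 z.2) (xb1 z.1 z.2)) @ in_prob P
    --> q true true + J1.
  rewrite -[J1]mul1r.
  exact: (cmean2 true true _ _ _ (hq true true) (hq true true) (hq true true)).
have ab : (fun z => qf (Sigma z.1) (xb0 z.1 z.2) (xb1 z.1 z.2)) @ in_prob P
    --> q false true.
  rewrite -[q false true]addr0 -[X in _ + X](mul0r J0).
  exact: (cmean2 false true _ _ _ (hq false true) (hq false false) (hq true true)).
have ba : (fun z => qf (Sigma z.1) (xb1 z.1 z.2) (xb0 z.1 z.2)) @ in_prob P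
    --> q false true.
  rewrite -q10 -[q true false]addr0 -[X in _ + X](mul0r J1).
  exact: (cmean2 true false _ _ _ (hq true false) (hq true true) (hq false false)).
have mua i : (fun z => qf (Sigma z.1) (if i then mu1 z.1 else mu0 z.1) (xb0 z.1 z.2))
    @ in_prob P --> q i false.
  exact: (cmean (fun p => if i then mu1 p else mu0 p) false _ _ (hq i i) (hq i false)).
have mub i : (fun z => qf (Sigma z.1) (if i then mu1 z.1 else mu0 z.1) (xb1 z.1 z.2))
    @ in_prob P --> q i true.
  exact: (cmean (fun p => if i then mu1 p else mu0 p) true _ _ (hq i i) (hq i true)).
have ma i : (fun z => qf (Sigma z.1) (if i then m1 z.1 else m0 z.1) (xb0 z.1 z.2))
    @ in_prob P --> r i false.
  exact: (cmean (fun p => if i then m1 p else m0 p) false _ _ (hs i) (hr i false)).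
have mb i : (fun z => qf (Sigma z.1) (if i then m1 z.1 else m0 z.1) (xb1 z.1 z.2))
    @ in_prob P --> r i true.
  exact: (cmean (fun p => if i then m1 p else m0 p) true _ _ (hs i) (hr i true)).
have DE : D = (q false false + J0) - 2 * q false true + (q true true + J1).
  by rewrite /D delta2E; ring.
have [w0 v0 k0] :=
  @cvg_prior_weights R n0 nu0 gam0 Hgam0 (fun p => (Hnu p).1) Hn0 Hgam0lim.
have [w1 v1 k1] :=
  @cvg_prior_weights R n1 nu1 gam1 Hgam1 (fun p => (Hnu p).2) Hn1 Hgam1lim.
have g0_neq0 : 1 + gam0 != 0 by rewrite gt_eqF// ltr_pwDl.
have g1_neq0 : 1 + gam1 != 0 by rewrite gt_eqF// ltr_pwDl.
have epsB_lim (i : nat) : (i < 2)%N -> (fun z => epsB z.1 i z.2) @ in_prob P -->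
    Phi ((-1) ^+ i * ((- GB i + c) / Num.sqrt D)).
  case: i => [|[|//]] _.
    have -> : GB 0%N = (1 + gam0)^-1 * (q false false + J0) +
        gam0 / (1 + gam0) * r false false -
        ((1 + gam0)^-1 * q false true + gam0 / (1 + gam0) * r false true) -
        2^-1 * (q false false + J0 - (q true true + J1)).
      by rewrite /GB/= delta2E eta01 eta00; field.
    exact: (cvg_bayes_err (c := c) (i := 0%N) aa ab ba bb DE HD aa ab
      (ma false) (mb false) (cvg_in_prob_det P w0) (cvg_in_prob_det P v0)
      (cvg_in_prob_det P k0)).
  have -> : GB 1%N = (1 + gam1)^-1 * q false true +
      gam1 / (1 + gam1) * r true false -
      ((1 + gam1)^-1 * (q true true + J1) + gam1 / (1 + gam1) * r true true) -
      2^-1 * (q false false + J0 - (q true true + J1)).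
    by rewrite /GB/= delta2E eta10 eta11; field.
  exact: (cvg_bayes_err (c := c) (i := 1%N) aa ab ba bb DE HD ba bb
    (ma true) (mb true) (cvg_in_prob_det P w1) (cvg_in_prob_det P v1)
    (cvg_in_prob_det P k1)).
have eps_lim (j : nat) : (j < 2)%N -> (fun z => eps z.1 j z.2) @ in_prob P -->
    Phi ((-1) ^+ j * ((- G j + c) / Num.sqrt D)).
  case: j => [|[|//]] _.
    have -> : (-1) ^+ 0 * ((- G 0%N + c) / Num.sqrt D) =
        ((-1) ^+ 1 * (q false false - q false true -
          2^-1 * (q false false + J0 - (q true true + J1))) + (-1) ^+ 0 * c) /
        Num.sqrt D.
      by rewrite /G/= delta2E mulrA; congr (_ / _); field.
    exact: (cvg_lda_err (c := c) (i := 0%N) aa ab ba bb DE HD (mua false) (mub false)).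
  have -> : (-1) ^+ 1 * ((- G 1%N + c) / Num.sqrt D) =
      ((-1) ^+ 2 * (q true false - q true true -
        2^-1 * (q false false + J0 - (q true true + J1))) + (-1) ^+ 1 * c) /
      Num.sqrt D.
    by rewrite /G/= delta2E q10 mulrA; congr (_ / _); field.
  exact: (cvg_lda_err (c := c) (i := 1%N) aa ab ba bb DE HD (mua true) (mub true)).
have mxb0 p : rvec (xb0 p) by apply: rvec_smean => k; exact: mX.
have mxb1 p : rvec (xb1 p) by apply: rvec_smean => k; exact: mX.
have meps p j : measurable_fun setT (eps p j) by exact: measurable_lda_err.
have mepsB p i : measurable_fun setT (epsB p i).
  by case: i => [|i]; exact: measurable_bayes_err.
have eps_le1 p j t : `|eps p j t| <= 1 by rewrite ger0_norm ?Phi_ge0 ?Phi_le1.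
have epsB_le1 p i t : `|epsB p i t| <= 1.
  by case: i => [|i]; rewrite ger0_norm ?Phi_ge0 ?Phi_le1.
split.
  move=> i j; apply: (@cvg_expectation_in_prob _ _ _ P
    (fun p t => epsB p i t * eps p j t) 1).
  - by move=> p; exact: measurable_funM.
  - by move=> p t; rewrite normrM mulr_ile1.
  - by apply: cvgM; [exact: epsB_lim|exact: eps_lim].
have -> : \sum_(i < 2) \sum_(j < 2) alpha i * alpha j * lim_ij i j =
    (alpha0 * Phi ((-1) ^+ 0 * ((- GB 0%N + c) / Num.sqrt D)) +
     alpha1 * Phi ((-1) ^+ 1 * ((- GB 1%N + c) / Num.sqrt D))) *
    (alpha0 * Phi ((-1) ^+ 0 * ((- G 0%N + c) / Num.sqrt D)) +
     alpha1 * Phi ((-1) ^+ 1 * ((- G 1%N + c) / Num.sqrt D))).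
  rewrite !big_ord_recl !big_ord0 /= /alpha /lim_ij /=.
  set x0 := Phi _; set y0 := Phi _; set y1 := Phi _; set x1 := Phi _.
  by ring.
have mix_le (x y : R) : `|x| <= 1 -> `|y| <= 1 ->
    `|alpha0 * x + alpha1 * y| <= `|alpha0| + `|alpha1|.
  move=> x1 y1; apply: le_trans (ler_normD _ _) _; rewrite !normrM.
  by rewrite lerD// ler_piMr.
have mix_lim (f g : nat * T -> R) (x y : R) : f @ in_prob P --> x ->
    g @ in_prob P --> y ->
    (fun z => alpha0 * f z + alpha1 * g z) @ in_prob P --> alpha0 * x + alpha1 * y.
  by move=> fx gy; apply: cvgD; apply: cvgM => //; exact: cvg_cst.
apply: (@cvg_expectation_in_prob _ _ _ P
  (fun p t => (alpha0 * epsB p 0%N t + alpha1 * epsB p 1%N t) *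
    (alpha0 * eps p 0%N t + alpha1 * eps p 1%N t))
  ((`|alpha0| + `|alpha1|) * (`|alpha0| + `|alpha1|))).
- move=> p; apply: measurable_funM; apply: measurable_funD; exact: measurable_funM.
- by move=> p t; rewrite normrM ler_pM//; exact: mix_le.
- apply: cvgM; apply: mix_lim; [exact: epsB_lim..|exact: eps_lim|exact: eps_lim].
Qed.
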